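(* Let $s\in(0,1)$ with $N-d<2s<N$ and $\alpha=s-\frac{N-d}2$. Let $u$ be the unique solution of the abstract Cauchy problem $$(P)\quad\frac{\partial u(t)}{\partial t}=A(t)u(t)+J(u(t))\ \text{ for }t\in[0,T],\qquad u(0)=\phi.$$ Then for every fixed $t\in(0,T]$ one has $$\begin{cases}\frac{\partial u}{\partial t}(t,x)+\mathcal B^{s,t}_\Omega u(t,x)=J(u(t,x))&\text{for a.e. }x\in\Omega,\\[1mm]\frac{\partial u}{\partial t}+C_s\mathcal N^K_{2-2s}u+bu+\Theta^t_\alpha(u)=J(u)&\text{in }(B^{2,2}_\alpha(\partial\Omega))',\\[1mm]u(0,x)=\phi(x)&\text{in }L^2(\Omega,m).\end{cases}$$
   Context: Setting. $\Omega\subset\mathbb R^N$ is a bounded $(\varepsilon,\delta)$ domain, i.e. $\Omega$ is open and connected and, with $d(x)=\inf_{y\notin\Omega}|x-y|$, whenever $x,y\in\Omega$ and $|x-y|<\delta$ there is a rectifiable arc $\gamma\subset\Omega$ joining $x$ to $y$ with length $\ell(\gamma)\le\frac1\varepsilon|x-y|$ and $d(z)\ge\frac{\varepsilon|x-z||y-z|}{|x-y|}$ for all $z\in\gamma$. The boundary $\partial\Omega$ is a $d$-set, $0<d\le N$: there are a Borel measure $\mu$ with $\operatorname{supp}\mu=\partial\Omega$ and constants $c_1,c_2>0$ with $c_1r^d\le\mu(B(x,r)\cap\partial\Omega)\le c_2r^d$ for every $x\in\partial\Omega$ and $0<r\le1$. Moreover $\Omega=\bigcup_n\Omega_n$ with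 $\Omega_n$ bounded Lipschitz domains and $\Omega_n\subseteq\Omega_{n+1}$. $T>0$ is fixed; $\mathfrak L(X)$ denotes the bounded linear operators on $X$. $H^s(\Omega)$ has norm $\|u\|_{H^s(\Omega)}^2=\|u\|_{L^2(\Omega)}^2+\iint_{\Omega\times\Omega}\frac{(u(x)-u(y))^2}{|x-y|^{N+2s}}\,d\mathcal L_N(x)\,d\mathcal L_N(y)$ ($\mathcal L_N$ Lebesgue measure). The trace is $u|_{\partial\Omega}(x)=\lim_{r\to0}\frac1{|B(x,r)\cap\Omega|}\int_{B(x,r)\cap\Omega}u\,d\mathcal L_N$ ($\mu$-a.e.); it maps $H^s(\Omega)$ boundedly onto the Besov space $B^{2,2}_\alpha(\partial\Omega)$, whose norm is $\|u\|^2=\|u\|_{L^2(\partial\Omega,\mu)}^2+\iint_{|x-y|<1}\frac{|u(x)-u(y)|^2}{|x-y|^{d+2\alpha}}\,d\mu(x)\,d\mu(y)$; primes denote duals, and $L^2(\partial\Omega,\mu)\subset(B^{2,2}_\alpha(\partial\Omega))'$ via the $L^2(\partial\Omega,\mu)$ pairing. $m=\mathcal L_N+\mu$ (Lebesgue measure on $\Omega$ plus $\mu$ on $\partial\Omega$), $\|u\|_{L^q(\Omega,m)}^q=\|u\|_{L^q(\Omega)}^q+\|u|_{\partial\Omega}\|_{L^q(\partial\Omega)}^q$; an element of $L^2(\Omega,m)$ has a component on $\Omega$ and one on $\partial\Omega$; $H^s(\Omega)\subset L^2(\Omega,m)$ through traces. In the boundary equation $\partial_tu$ and $J(u)$ denote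 the boundary components. Data. $K:[0,T]\times\Omega\times\Omega\to\mathbb R$ and $\zeta:[0,T]\times\partial\Omega\times\partial\Omega\to\mathbb R$ are measurable, symmetric in the last two variables, with $k_1\le K\le k_2$ and $\zeta_1\le\zeta\le\zeta_2$ a.e. for constants $0<k_1<k_2$, $0<\zeta_1<\zeta_2$; $b\in L^\infty([0,T]\times\partial\Omega)$ with $\inf b>b_0>0$; and for a fixed exponent $\eta\in(\frac12,1)$ and constants $c,C$: $|b(t,P)-b(\tau,P)|\le c|t-\tau|^\eta$, $|K(t,x,y)-K(\tau,x,y)|\le C|t-\tau|^\eta$, $|\zeta(t,x,y)-\zeta(\tau,x,y)|\le C|t-\tau|^\eta$ for $t,\tau\in[0,T]$ and (almost) all points. $C_{N,s}=\frac{s2^{2s}\Gamma(\frac{N+2s}2)}{\pi^{N/2}\Gamma(1-s)}$. Boundary operator: $\Theta^t_\alpha:B^{2,2}_\alpha(\partial\Omega)\to(B^{2,2}_\alpha(\partial\Omega))'$, $\langle\Theta^t_\alpha(u),v\rangle=\iint_{\partial\Omega\times\partial\Omega}\zeta(t,x,y)\frac{(u(x)-u(y))(v(x)-v(y))}{|x-y|^{d+2\alpha}}\,d\mu(x)\,d\mu(y)$. For $u,v\in H^s(\Omega)$ let $\mathcal K_t(u,v)=\frac{C_{N,s}}2\iint_{\Omega\times\Omega}K(t,x,y)\frac{(u(x)-u(y))(v(x)-v(y))}{|x-y|^{N+2s}}\,d\mathcal L_N(x)\,d\mathcal L_N(y)$ and $$E(t,u,v)=\mathcal K_t(u,v)+\int_{\partial\Omega}b(t,P)\,u|_{\partial\Omega}v|_{\partial\Omega}\,d\mu+\langle\Theta^t_\alpha(u|_{\partial\Omega}),v|_{\partial\Omega}\rangle.$$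 $A(t)$ is the unique selfadjoint non-positive operator on $L^2(\Omega,m)$ with dense domain $D(A(t))\subset H^s(\Omega)$ such that $E(t,u,v)=(-A(t)u,v)_{L^2(\Omega,m)}$ for $u\in D(A(t))$, $v\in H^s(\Omega)$. Bulk operator: $\mathcal B^{s,t}_\Omega u(t,x)=C_{N,s}\lim_{\epsilon\to0^+}\int_{\{y\in\Omega:|x-y|>\epsilon\}}K(t,x,y)\frac{u(t,x)-u(t,y)}{|x-y|^{N+2s}}\,d\mathcal L_N(y)$, understood in the sense of distributions: $\langle\mathcal B^{s,t}_\Omega u,\varphi\rangle=\mathcal K_t(u,\varphi)$ for $\varphi\in C_c^\infty(\Omega)$. For $u\in H^s(\Omega)$ with $\mathcal B^{s,t}_\Omega u\in L^2(\Omega)$, the fractional conormal derivative $C_s\mathcal N^K_{2-2s}u\in(B^{2,2}_\alpha(\partial\Omega))'$ is the functional given by $\langle C_s\mathcal N^K_{2-2s}u,v|_{\partial\Omega}\rangle=-\int_\Omega\mathcal B^{s,t}_\Omega u\,v\,d\mathcal L_N+\mathcal K_t(u,v)$ for all $v\in H^s(\Omega)$ (well defined), with $C_s=\frac{C_{1,s}}{2s(2s-1)}\int_0^\infty\frac{|z-1|^{1-2s}-(z\vee1)^{1-2s}}{z^{2-2s}}\,dz$. Evolution family. $U(t,\tau)\in\mathfrak L(L^2(\Omega,m))$, $0\le\tau\le t\le T$, is the unique family with $U(\tau,\tau)=\mathrm{Id}$; $U(t,\tau)U(\tau,\sigma)=U(t,\sigma)$ for $\sigma\le\tau\le t$; $\|U(t,\tau)\|\le1$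 and strong continuity; $t\mapsto U(t,\tau)$ differentiable on $(\tau,T]$ in $\mathfrak L(L^2(\Omega,m))$ with $\partial_tU(t,\tau)=A(t)U(t,\tau)$; $A(t)U(t,\tau)$ continuous for $\tau<t$ with $\|A(t)U(t,\tau)\|\le C/(t-\tau)$. Nonlinearity and solution. $p>1$; $J:L^{2p}(\Omega,m)\to L^2(\Omega,m)$ satisfies $J(0)=0$ and $\|J(u)-J(v)\|_{L^2(\Omega,m)}\le l(r)\|u-v\|_{L^{2p}(\Omega,m)}$ whenever $\|u\|_{L^{2p}(\Omega,m)},\|v\|_{L^{2p}(\Omega,m)}\le r$; with $\lambda=\frac{2d}{d-N+2s}$ and $a=\frac\lambda4(1-\frac1p)$ there is $0<\varrho<a$ with $l(r)=\mathcal O(r^{\frac{1-a}\varrho})$ as $r\to+\infty$; $\phi\in L^2(\Omega,m)$ with $\limsup_{t\to0^+}\|t^\varrho U(t,0)\phi\|_{L^{2p}(\Omega,m)}<\kappa$ for a sufficiently small $\kappa>0$. The unique solution $u$ of $(P)$ is the mild solution, $u(t)=U(t,0)\phi+\int_0^tU(t,\tau)J(u(\tau))\,d\tau$, taken to exist on $[0,T]$; it is classical: $u\in C([0,T],L^2(\Omega,m))\cap C((0,T],L^{2p}(\Omega,m))\cap C^1((0,T],L^2(\Omega,m))$, $A(\cdot)u(\cdot)\in C((0,T];L^2(\Omega,m))$, and the equation in $(P)$ holds for $t\in(0,T]$. *)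

(* Defs.v *)
From HB Require Import structures.
From mathcomp Require Import all_boot all_order all_algebra.
From mathcomp Require Import all_classical all_reals all_analysis.
From mathcomp Require Import measurable_realfun.

Set Implicit Arguments.
Unset Strict Implicit.
Unset Printing Implicit Defensive.

Import Order.TTheory GRing.Theory Num.Theory.
Import numFieldNormedType.Exports.

Local Open Scope classical_set_scope.
Local Open Scope ring_scope.

HB.instance Definition _ (R : realType) (m n : nat) :=
  @isMeasurable.Build (sigma_display (@open 'M[R]_(m, n))) 'M[R]_(m, n)
    <<s @open 'M[R]_(m, n) >> (@sigma_algebra0 _ setT _) (@sigma_algebraC _ _)
    (@sigma_algebra_bigcup _ setT _).

Section lebesgue_rV.
Variable R : realType.

Lemma open_measurable_mx m n (U : set 'M[R]_(m, n)) : open U -> measurable U.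
Proof. exact: sub_sigma_algebra. Qed.

Lemma measurable_fun_rV d (T : measurableType d) n (f : T -> 'rV[R]_n) :
  (forall j, measurable_fun setT (fun x => f x 0 j)) -> measurable_fun setT f.
Proof.
move=> mf; apply: (@measurability _ _ _ _ _ _ (@open 'rV[R]_n)) => //.
move=> _ [U oU <-]; rewrite setTI.
pose B (c : 'rV[rat]_n * nat) : set 'rV[R]_n :=
  [set x | forall j, ball (ratr (c.1 0 j) : R) (c.2.+1%:R^-1) (x 0 j)].
pose D := [set c | B c `<=` U].
have -> : U = \bigcup_(c in D) B c.
  apply/seteqP; split => [x Ux|x [c cD]]; last exact: cD.
  move/open_nbhs_nbhs : (conj oU Ux : open_nbhs x U).
  move=> /nbhs_ballP[e /= e0 xeU].
  have [k /= ke] : exists k, (k.+1%:R^-1 : R) < e / 2.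
    have e20 : 0 < e / 2 by rewrite divr_gt0.
    have [k _ /(_ k (leqnn k)) ke] := near_infty_natSinv_lt (PosNum e20).
    by exists k.
  have H j : exists q : rat, ball (ratr q : R) (k.+1%:R^-1) (x 0 j).
    have r0 : 0 < k.+1%:R^-1 :> R by rewrite invr_gt0.
    have : x 0 j - k.+1%:R^-1 < x 0 j + k.+1%:R^-1.
      by rewrite ltrD2l gtrN.
    move=> /rat_in_itvoo[q]; rewrite in_itv/= => /andP[q1 q2]; exists q.
    by rewrite /ball/= ltr_distl q1 q2.
  have [c cP] := choice H.
  exists (\row_j c j, k); last by move=> j; rewrite /= mxE; exact: cP.
  move=> y By; apply: xeU; split => // i j.
  rewrite ord1 (splitr e).
  apply: (@ball_triangle _ R (ratr (c j))).
    by apply: (le_ball (ltW ke)); apply: ball_sym; exact: cP.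
  by apply: (le_ball (ltW ke)); have := By j; rewrite /= mxE.
rewrite bigcup_mkcond preimage_bigcup.
apply: countable_bigcupT_measurable => [|c]; first exact: countableP.
case: ifP => _; last by rewrite preimage_set0.
have -> : f @^-1` B c = \bigcap_(j in [set: 'I_n])
    ((fun x => f x 0 j) @^-1` ball (ratr (c.1 0 j) : R) (c.2.+1%:R^-1)).
  by apply/seteqP; split => [x Bx j _|x Bx j]; [exact: Bx|exact: Bx].
apply: fin_bigcap_measurable => // j _.
rewrite -[X in measurable X]setTI; apply: mf => //; apply: open_measurable.
exact: ball_open.
Qed.

Definition cons_rV n (p : measurableTypeR R * 'rV[R]_n) : 'rV[R]_n.+1 :=
  row_mx (p.1%:M : 'rV_1) p.2 : 'rV_(1 + n).

Lemma cons_rV0 n p : @cons_rV n p 0 0 = p.1.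
Proof.
by rewrite (_ : 0 = lshift n (0 : 'I_1)) ?(@row_mxEl _ 1 1 n) ?mxE//; exact/val_inj.
Qed.

Lemma cons_rVS n p j : @cons_rV n p 0 (lift 0 j) = p.2 0 j.
Proof.
by rewrite (_ : lift 0 j = rshift 1 j) ?(@row_mxEr _ 1 1 n)//; exact/val_inj.
Qed.

Lemma measurable_coord m n (i : 'I_m) (j : 'I_n) :
  measurable_fun setT (fun A : 'M[R]_(m, n) => A i j).
Proof.
apply: (measurability _ (RGenOpens.measurableE R)).
move=> _ [_ [a [b ->] <-]]; rewrite setTI; apply: open_measurable_mx.
by apply: open_comp (interval_open _ _) => // M _; exact: coord_continuous.
Qed.

Lemma measurable_cons_rV n : measurable_fun setT (@cons_rV n).
Proof.
apply: measurable_fun_rV => j; have [k ->|->] := unliftP 0 j.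
  under eq_fun do rewrite cons_rVS.
  exact: (measurableT_comp (measurable_coord 0 k) measurable_snd).
under eq_fun do rewrite cons_rV0; exact: measurable_fst.
Qed.

Let uncons n (x : 'rV[R]_n.+1) : measurableTypeR R * 'rV[R]_n := (x 0 0, \row_j x 0 (lift 0 j)).

Let measurable_uncons n : measurable_fun setT (@uncons n).
Proof.
apply/measurable_fun_pairP; split; first exact: measurable_coord.
apply: measurable_fun_rV => j.
rewrite (_ : (fun _ => _) = (fun x : 'rV[R]_n.+1 => x 0 (lift 0 j))).
  exact: measurable_coord.
by apply/funext => x; rewrite /= mxE.
Qed.

Let cons_rVK n : cancel (@cons_rV n) (@uncons n).
Proof.
move=> [t x]; congr (_, _); first exact: cons_rV0.
by apply/rowP => j; rewrite mxE cons_rVS.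
Qed.

Section step.
Variables (n : nat) (mu : {sigma_finite_measure set 'rV[R]_n -> \bar R}).

Definition cons_measure : set 'rV[R]_n.+1 -> \bar R :=
  pushforward (@lebesgue_measure R \x mu)%E (@cons_rV n).

Let pm : {measure set 'rV[R]_n.+1 -> \bar R} :=
  measure_function_pushforward__canonical__measure_function_Measure
    (@lebesgue_measure R \x mu)%E (@measurable_cons_rV n).

HB.instance Definition _ := isMeasure.Build _ _ _ cons_measure
  (measure0 pm) (measure_ge0 pm) (@measure_semi_sigma_additive _ _ _ pm).

Let sigma_finite_cons : sigma_finite setT cons_measure.
Proof.
have /sigma_finiteP[F [TF ndF Foo]] := sigma_finiteT (@lebesgue_measure R).
have /sigma_finiteP[G [TG ndG Goo]] := sigma_finiteT mu.
exists (fun k => @uncons n @^-1` (F k `*` G k)) => [|k].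
  apply/seteqP; split => // x _.
  have [i _ Fi] : (\bigcup_k F k) (uncons x).1 by rewrite -TF.
  have [j _ Gj] : (\bigcup_k G k) (uncons x).2 by rewrite -TG.
  exists (maxn i j) => //; split.
    by move: Fi; exact/subsetPset/ndF/leq_maxl.
  by move: Gj; exact/subsetPset/ndG/leq_maxr.
have [mF Fk] := Foo k; have [mG Gk] := Goo k.
split.
  rewrite -[X in measurable X]setTI; apply: measurable_uncons => //.
  exact: measurableX.
rewrite /cons_measure /pushforward -comp_preimage.
rewrite (_ : _ \o _ = id) ?preimage_id; last exact/funext/cons_rVK.
by rewrite product_measure1E// lte_mul_pinfty// ge0_fin_numE.
Qed.

HB.instance Definition _ := Measure_isSigmaFinite.Build _ _ _ cons_measure sigma_finite_cons.

End step.

Fixpoint lebesgue_rV n : {sigma_finite_measure set 'rV[R]_n -> \bar R} :=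
  match n with
  | 0 => @dirac _ 'rV[R]_0 (0 : 'rV[R]_0) R
  | k.+1 => cons_measure (lebesgue_rV k)
  end.

Lemma lebesgue_rV_box n (I : 'I_n -> set R) : (forall i, measurable (I i)) ->
  lebesgue_rV n [set x | forall i, I i (x 0 i)] =
  (\prod_(i < n) @lebesgue_measure R (I i))%E.
Proof.
elim: n I => [|n IH] I mI /=.
  by rewrite big_ord0 diracE mem_set// => -[].
rewrite big_ord_recl /cons_measure /pushforward.
have mbox : measurable [set x : 'rV[R]_n | forall i, I (lift 0 i) (x 0 i)].
  rewrite (_ : [set x | _] = \bigcap_(i in [set: 'I_n])
      ((fun x : 'rV[R]_n => x 0 i) @^-1` I (lift 0 i))).
    apply: fin_bigcap_measurable => // i _.
    by rewrite -[X in measurable X]setTI; exact: measurable_coord.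
  by apply/seteqP; split => [x Bx i _|x Bx i]; exact: Bx.
rewrite -(IH (fun i => I (lift 0 i)))// -product_measure1E//; last exact: mI.
congr product_measure1; apply/seteqP; split => [[t x] /= tx|[t x] /= [It Ix] i].
  by split=> [|i]; [have := tx 0; rewrite cons_rV0|have := tx (lift 0 i); rewrite cons_rVS].
by have [j ->|->] := unliftP 0 i; rewrite ?cons_rV0 ?cons_rVS.
Qed.

End lebesgue_rV.

Section euclidean.
Variables (R : realType) (N : nat).
Local Notation X := 'rV[R]_N.
Implicit Types (x y z : X) (D : set X).

Definition enorm x : R := Num.sqrt (\sum_(i < N) x 0 i ^+ 2).

Definition eball x (r : R) : set X := [set y | enorm (x - y) < r].

Definition edot x y : R := \sum_(i < N) x 0 i * y 0 i.

Definition boundary D : set X := closure D `\` D°.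

Lemma measurable_boundary D : measurable (boundary D).
Proof.
have mo U : open U -> measurable (U : set X) by exact: open_measurable_mx.
apply: measurableD; last by apply: mo; exact: open_interior.
rewrite -[closure D]setCK; apply: measurableC; apply: mo.
exact/closed_openC/closed_closure.
Qed.

Definition curve_length (g : R -> X) : \bar R :=
  ereal_sup [set (\sum_(k < size r)
      enorm (nth 0 (map g r) k - nth 0 (map g (0 :: r)) k))%:E
    | r in [set r : seq R | itv_partition 0 1 r]].

Definition dist_compl D x : R := inf [set enorm (x - y) | y in ~` D].

Definition eps_delta_domain (eps delta : R) D :=
  [/\ 0 < eps, 0 < delta, open D, connected D &
   forall x y, D x -> D y -> enorm (x - y) < delta ->
   exists g : R -> X,
    [/\ {within `[0, 1], continuous g}, g 0 = x, g 1 = y,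
        (curve_length g <= (eps^-1 * enorm (x - y))%:E)%E &
        forall r, r \in `[0, 1] ->
          D (g r) /\
          eps * enorm (x - g r) * enorm (y - g r) / enorm (x - y)
            <= dist_compl D (g r)]].

(* Near each boundary point, D is the part of a ball lying above the graph of
   a Lipschitz function of the variables orthogonal to a unit vector e; g is
   defined on the whole space but the Lipschitz bound makes it depend only on
   the projection onto the orthogonal of e. *)
Definition lipschitz_domain D :=
  [/\ open D, connected D &
   forall z, boundary D z ->
   exists (r M : R) (e : X) (g : X -> R),
    [/\ 0 < r, enorm e = 1,
        forall x y, `|g x - g y| <=
          M * enorm ((x - edot x e *: e) - (y - edot y e *: e)) &
        forall x, eball z r x -> (D x <-> g x < edot x e)]].

Definition lipschitz_exhaustion D :=
  exists Dn : nat -> set X,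
    [/\ forall n, lipschitz_domain (Dn n) /\ bounded_set (Dn n),
        forall n, Dn n `<=` Dn n.+1 & D = \bigcup_n Dn n].

Definition measure_support (mu : set X -> \bar R) : set X :=
  [set x | forall r, 0 < r -> (0 < mu (eball x r))%E].

Definition d_set (d : R) (mu : set X -> \bar R) (F : set X) :=
  [/\ 0 < d <= N%:R, measure_support mu = F &
   exists c1 c2 : R, [/\ 0 < c1, 0 < c2 &
    forall x r, F x -> 0 < r <= 1 ->
      ((c1 * r `^ d)%:E <= mu (eball x r `&` F) <= (c2 * r `^ d)%:E)%E]].

Definition test_function D (f : X -> R) :=
  (forall (vs : seq X) x,
     differentiable (foldr (fun v h => derive h ^~ v) f vs : X -> R) x) /\
  exists2 C : set X, compact C /\ C `<=` D & forall x, ~ C x -> f x = 0.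

End euclidean.

Section hilbert_L2.
Context d (T : measurableType d) (R : realType).
Variable m : {measure set T -> \bar R}.
Implicit Types (f g h : T -> R) (A B : (T -> R) -> T -> R) (D : set (T -> R)).

Local Notation L2 := (Lfun m 2%:E).
Local Notation "'N_ q [ f ]" := (Lnorm m q (EFin \o f%R)).

Definition L2dot f g : R := \int[m]_x (f x * g x).

(* Elements of L^q(m) are represented by functions and identified m-a.e.;
   convergence is convergence in norm. *)
Definition Lq_cvg (q : R) (I : Type) (F : set_system I) (f : I -> T -> R) g :=
  'N_q%:E [f i \- g] @[i --> F] --> 0%E.

Definition linear_on D A :=
  forall (c : R) f g, D f -> D g ->
    D (c \*o f \+ g) /\ A (c \*o f \+ g) = (c \*o A f \+ A g) %[ae m].

Definition bounded_operator B :=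
  [/\ forall f, f \in L2 -> B f \in L2,
      linear_on [set f | f \in L2] B &
      exists C : R, forall f, f \in L2 -> ('N_2%:E [B f] <= C%:E * 'N_2%:E [f])%E].

Definition opnorm B : \bar R :=
  ereal_sup [set 'N_2%:E [B f] | f in [set f | f \in L2 /\ ('N_2%:E [f] <= 1)%E]].

(* The last clause says that A coincides with its adjoint. *)
Definition selfadjoint D A :=
  [/\ forall f, D f -> f \in L2 /\ A f \in L2,
      linear_on D A,
      forall f (e : R), f \in L2 -> 0 < e ->
        exists2 g, D g & ('N_2%:E [f \- g] < e%:E)%E &
      forall g h, g \in L2 -> h \in L2 ->
        (D g /\ A g = h %[ae m]) <-> (forall f, D f -> L2dot (A f) g = L2dot f h)].

Definition nonpositive D A := forall f, D f -> L2dot (A f) f <= 0.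

(* Bochner integral over ]a, b[ of an L^2(m)-valued function F: the k-th simple
   function takes the value c k i on E k i for i < n k. *)
Definition is_bochner_integral (a b : R) (F : R -> T -> R) (I : T -> R) :=
  exists (n : nat -> nat) (E : nat -> nat -> set (measurableTypeR R))
         (c : nat -> nat -> T -> R),
  let S k (r : R) : T -> R := fun x => \sum_(i < n k) \1_(E k i) r * c k i x in
  let D : set (measurableTypeR R) := `]a, b[%classic in
  [/\ forall k i, measurable (E k i) /\ c k i \in L2,
      forall k, measurable_fun D (fun r => 'N_2%:E [F r \- S k r]),
      (\int[lebesgue_measure]_(r in D) 'N_2%:E [F r \- S k r])%E
        @[k --> \oo] --> 0%E &
      Lq_cvg 2 \oo (fun k x =>
        \sum_(i < n k) fine (lebesgue_measure (E k i `&` D)) * c k i x) I].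

Definition L2_derivative (I : set R) (u : R -> T -> R) (t : R) (w : T -> R) :=
  Lq_cvg 2 (within I t^') (fun r x => (r - t)^-1 * (u r x - u t x)) w.

Section evolution.
Variables (Tf : R) (DA : R -> set (T -> R)) (A : R -> (T -> R) -> T -> R).

Let triangle : set (R * R) := [set q | 0 <= q.2 <= q.1 /\ q.1 <= Tf].
Let open_triangle : set (R * R) := [set q | 0 <= q.2 < q.1 /\ q.1 <= Tf].

Record evolution_family (U : R -> R -> (T -> R) -> T -> R) : Prop :=
  EvolutionFamily {
  evol_bounded : forall t tau, triangle (t, tau) -> bounded_operator (U t tau) ;
  evol_id : forall tau f, 0 <= tau <= Tf -> f \in L2 ->
    U tau tau f = f %[ae m] ;
  evol_comp : forall t tau sigma f, 0 <= sigma <= tau -> tau <= t <= Tf ->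
    f \in L2 -> U t tau (U tau sigma f) = U t sigma f %[ae m] ;
  evol_contraction : forall t tau, triangle (t, tau) ->
    (opnorm (U t tau) <= 1)%E ;
  evol_strong_cont : forall f q, f \in L2 -> triangle q ->
    Lq_cvg 2 (within triangle (nbhs q)) (fun q' => U q'.1 q'.2 f) (U q.1 q.2 f) ;
  evol_domain : forall t tau f, open_triangle (t, tau) -> f \in L2 ->
    DA t (U t tau f) ;
  evol_A_bounded : forall t tau, open_triangle (t, tau) ->
    bounded_operator (A t \o U t tau) ;
  evol_derivative : forall t tau, open_triangle (t, tau) ->
    opnorm (fun f x => (r - t)^-1 * (U r tau f x - U t tau f x)
                       - A t (U t tau f) x)
      @[r --> within `]tau, Tf] t^'] --> 0%E ;
  evol_A_cont : forall q, open_triangle q ->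
    opnorm (fun f => A q'.1 (U q'.1 q'.2 f) \- A q.1 (U q.1 q.2 f))
      @[q' --> within open_triangle (nbhs q)] --> 0%E ;
  evol_A_bound : exists C : R, forall t tau, open_triangle (t, tau) ->
    (opnorm (A t \o U t tau) <= (C / (t - tau))%:E)%E }.

End evolution.

Record nonlinearity (p a rho : R) (l : R -> R) (J : (T -> R) -> T -> R) : Prop :=
  Nonlinearity {
  nonlin_L2 : forall f, f \in Lfun m (2 * p)%:E -> J f \in L2 ;
  nonlin_0 : J (cst 0) = cst 0 %[ae m] ;
  nonlin_lipschitz : forall r f g,
    f \in Lfun m (2 * p)%:E -> g \in Lfun m (2 * p)%:E ->
    ('N_(2 * p)%:E [f] <= r%:E)%E -> ('N_(2 * p)%:E [g] <= r%:E)%E ->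
    ('N_2%:E [J f \- J g] <= (l r)%:E * 'N_(2 * p)%:E [f \- g])%E ;
  nonlin_growth : exists C : R,
    \forall r \near +oo, `|l r| <= C * r `^ ((1 - a) / rho) }.

Record cauchy_solution (Tf p : R) (DA : R -> set (T -> R))
    (A : R -> (T -> R) -> T -> R) (U : R -> R -> (T -> R) -> T -> R)
    (J : (T -> R) -> T -> R) (phi : T -> R) (u du : R -> T -> R) : Prop :=
  CauchySolution {
  sol_init : u 0 = phi %[ae m] ;
  sol_mild : forall t, 0 <= t <= Tf ->
    exists I, is_bochner_integral 0 t (fun tau => U t tau (J (u tau))) I /\
      u t = (U t 0 phi \+ I) %[ae m] ;
  sol_L2 : forall t, 0 <= t <= Tf -> u t \in L2 /\
    Lq_cvg 2 (within `[0, Tf] (nbhs t)) u (u t) ;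
  sol_L2p : forall t, 0 < t <= Tf -> u t \in Lfun m (2 * p)%:E /\
    Lq_cvg (2 * p) (within `]0, Tf] (nbhs t)) u (u t) ;
  sol_C1 : forall t, 0 < t <= Tf ->
    [/\ du t \in L2, L2_derivative `]0, Tf] u t (du t) &
        Lq_cvg 2 (within `]0, Tf] (nbhs t)) du (du t)] ;
  sol_domain : forall t, 0 < t <= Tf -> DA t (u t) /\
    Lq_cvg 2 (within `]0, Tf] (nbhs t)) (fun r => A r (u r)) (A t (u t)) ;
  sol_eq : forall t, 0 < t <= Tf ->
    du t = (A t (u t) \+ J (u t)) %[ae m] }.

End hilbert_L2.

Section forms.
Variables (R : realType) (N : nat).
Local Notation X := 'rV[R]_N.
Local Notation L := (lebesgue_rV R N).
Implicit Types (nu mu : {sigma_finite_measure set X -> \bar R}) (D Omega : set X).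

Record coefficient nu D (Tf k1 k2 eta : R) (k : R -> X -> X -> R) : Prop :=
  Coefficient {
  coef_measurable :
    measurable_fun (`[0, Tf]%classic `*` D `*` D : set (measurableTypeR R * X * X))
      (fun q => k q.1.1 q.1.2 q.2) ;
  coef_sym : forall t x y, 0 <= t <= Tf -> D x -> D y -> k t x y = k t y x ;
  coef_pos : 0 < k1 < k2 ;
  coef_bounds : {ae (@lebesgue_measure R \x nu \x nu)%E, forall q,
    0 <= q.1.1 <= Tf -> D q.1.2 -> D q.2 -> k1 <= k q.1.1 q.1.2 q.2 <= k2} ;
  coef_holder : exists C : R, forall t tau, 0 <= t <= Tf -> 0 <= tau <= Tf ->
    {ae (nu \x nu)%E, forall z, D z.1 -> D z.2 ->
      `|k t z.1 z.2 - k tau z.1 z.2| <= C * `|t - tau| `^ eta} }.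

Record potential mu D (Tf b0 eta : R) (b : R -> X -> R) : Prop := Potential {
  pot_measurable :
    measurable_fun (`[0, Tf]%classic `*` D : set (measurableTypeR R * X))
      (fun q => b q.1 q.2) ;
  pot_bounded : exists M : R, {ae (@lebesgue_measure R \x mu)%E, forall q,
    0 <= q.1 <= Tf -> D q.2 -> `|b q.1 q.2| <= M} ;
  pot_b0 : 0 < b0 ;
  pot_inf : exists2 b1 : R, b0 < b1 & {ae (@lebesgue_measure R \x mu)%E, forall q,
    0 <= q.1 <= Tf -> D q.2 -> b1 <= b q.1 q.2} ;
  pot_holder : exists c : R, forall t tau, 0 <= t <= Tf -> 0 <= tau <= Tf ->
    {ae mu, forall x, D x -> `|b t x - b tau x| <= c * `|t - tau| `^ eta} }.

Definition Gamma (x : R) : R :=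
  \int[lebesgue_measure]_(t in `]0%R, +oo[) (t `^ (x - 1) * expR (- t)).

Definition C_Ns (s : R) : R :=
  s * 2 `^ (2 * s) * Gamma ((N%:R + 2 * s) / 2) /
  (pi `^ (N%:R / 2) * Gamma (1 - s)).

Definition sq_integral nu D (f : X -> R) : \bar R :=
  (\int[nu]_(x in D) (f x ^+ 2)%:E)%E.

Definition gagliardo nu (DD : set (X * X)) (e : R) (f : X -> R) : \bar R :=
  (\int[nu \x nu]_(z in DD)
     ((f z.1 - f z.2) ^+ 2 / enorm (z.1 - z.2) `^ e)%:E)%E.

Definition gagliardo_form nu D (e : R) (k : X -> X -> R) (f g : X -> R) : R :=
  \int[(nu \x nu)%E]_(z in D `*` D)
    (k z.1 z.2 * ((f z.1 - f z.2) * (g z.1 - g z.2) / enorm (z.1 - z.2) `^ e)).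

Definition L2_on nu D (f : X -> R) :=
  measurable_fun D f /\ (sq_integral nu D f < +oo)%E.

Definition Hs Omega (s : R) (f : X -> R) :=
  L2_on L Omega f /\
  (gagliardo L (Omega `*` Omega) (N%:R + 2 * s) f < +oo)%E.

Definition near_diagonal D : set (X * X) :=
  [set z | D z.1 /\ D z.2 /\ enorm (z.1 - z.2) < 1].

Definition besov_sqnorm mu F (d alpha : R) (g : X -> R) : \bar R :=
  (sq_integral mu F g + gagliardo mu (near_diagonal F) (d + 2 * alpha) g)%E.

Definition besov mu F (d alpha : R) (g : X -> R) :=
  measurable_fun F g /\ (besov_sqnorm mu F d alpha g < +oo)%E.

Definition besov_dual mu F (d alpha : R) (ell : (X -> R) -> R) :=
  (forall (c : R) f g, besov mu F d alpha f -> besov mu F d alpha g ->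
     ell (c \*o f \+ g) = c * ell f + ell g) /\
  exists C : R, forall g, besov mu F d alpha g ->
    `|ell g| <= C * Num.sqrt (fine (besov_sqnorm mu F d alpha g)).

Definition is_trace mu Omega (f g : X -> R) :=
  {ae mu, forall x, boundary Omega x ->
    (fine (L (eball x r `&` Omega)))^-1 *
      (\int[L]_(y in eball x r `&` Omega) f y)
    @[r --> 0^'+] --> g x}.

(* The measure m: Lebesgue measure on Omega plus mu on its boundary. The
   restrictions to Omega and to its boundary of a function are the two
   components of its class modulo m. *)
Definition bulk_bdry mu Omega (oOmega : open Omega) : {measure set X -> \bar R} :=
  measure_add (mrestr L (open_measurable_mx oOmega))
              (mrestr mu (measurable_boundary Omega)).

(* H^s(Omega) inside L^2(Omega, m): the boundary component is the trace. *)
Definition Hs_trace mu Omega (oOmega : open Omega) (s d alpha : R) (v : X -> R) :=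
  [/\ v \in Lfun (bulk_bdry mu oOmega) 2%:E, Hs Omega s v,
      besov mu (boundary Omega) d alpha v & is_trace mu Omega v v].

Section energy.
Variables (mu : {sigma_finite_measure set X -> \bar R}) (Omega : set X).
Variables (oOmega : open Omega) (s d alpha : R).
Variables (K zeta : R -> X -> X -> R) (b : R -> X -> R).

Definition K_form (t : R) (f g : X -> R) : R :=
  C_Ns s / 2 * gagliardo_form L Omega (N%:R + 2 * s) (K t) f g.

Definition Theta (t : R) (f g : X -> R) : R :=
  gagliardo_form mu (boundary Omega) (d + 2 * alpha) (zeta t) f g.

Definition energy (t : R) (f g : X -> R) : R :=
  K_form t f g + \int[mu]_(x in boundary Omega) (b t x * f x * g x)
  + Theta t f g.

(* w represents in L^2(Omega) the distribution B f. *)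
Definition is_bulk_op (t : R) (f w : X -> R) :=
  L2_on L Omega w /\
  forall v, test_function Omega v -> \int[L]_(x in Omega) (w x * v x) = K_form t f v.

(* ell is the functional written C_s N f, where w represents B f; the constant
   C_s has no independent meaning here, only the product being defined. *)
Definition is_conormal (t : R) (f w : X -> R) (ell : (X -> R) -> R) :=
  besov_dual mu (boundary Omega) d alpha ell /\
  forall v, Hs_trace mu oOmega s d alpha v ->
    ell v = - (\int[L]_(x in Omega) (w x * v x)) + K_form t f v.

Definition generator (t : R) (D : set (X -> R)) (A : (X -> R) -> X -> R) :=
  [/\ selfadjoint (bulk_bdry mu oOmega) D A,
      nonpositive (bulk_bdry mu oOmega) D A,
      forall f, D f -> Hs_trace mu oOmega s d alpha f &
      forall f v, D f -> Hs_trace mu oOmega s d alpha v ->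
        energy t f v = L2dot (bulk_bdry mu oOmega) (\- A f) v].

End energy.
End forms.

(* Main.v *)
(* Test functions on Omega vanish near its boundary, hence lie in H^s(Omega)
   with zero trace, and the energy identity for A(t) u(t) against them says that
   B u = - A(t) u on Omega. The conormal derivative is then given explicitly by
     v |-> - (A(t) u, v) - (b u, v) - <Theta u, v>
   with pairings on the boundary. This is defined for every Besov function v, so
   surjectivity of the trace is not needed, and on traces of H^s functions it is
   the required functional by the energy identity again. It is bounded because
   the coefficients at a fixed time are bounded (by Hoelder continuity, from the
   bound at almost every time) and the boundary has finite measure. The boundary
   equation is the boundary component of u' = A(t) u + J(u). *)
Require Import Defs.
From HB Require Import structures.
From mathcomp Require Import all_boot all_order all_algebra.
From mathcomp Require Import all_classical all_reals all_analysis.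
From mathcomp Require Import measurable_realfun lra ring.

Set Implicit Arguments.
Unset Strict Implicit.
Unset Printing Implicit Defensive.

Import Order.TTheory GRing.Theory Num.Theory.
Import numFieldNormedType.Exports.

Local Open Scope classical_set_scope.
Local Open Scope ring_scope.

(** The free parameter is chosen optimally: at [c = (Num.sqrt q)^-1] the right-hand side equals
    [2 * C]. When [q = 0] the right-hand side stays at [C] for every [c], and [c = (C + 1) / x]
    would violate it unless [x = 0]. *)
Lemma quadratic_form_bound (R : realType) (x C q : R) : 0 <= C -> 0 <= q ->
  (forall c, `|c * x| <= C * (1 + c ^+ 2 * q)) -> `|x| <= 2 * C * Num.sqrt q.
Proof.
move=> C0; rewrite le_eqVlt => /predU1P[<-|q0] H.
  rewrite sqrtr0 mulr0 normr_le0; apply/eqP; apply: contrapT => /eqP x0.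
  have := H ((C + 1) / x); rewrite mulfVK// mulr0 addr0 mulr1 ger0_norm; lra.
have s0 : 0 < Num.sqrt q by rewrite sqrtr_gt0.
have := H (Num.sqrt q)^-1.
rewrite exprVn sqr_sqrtr ?(ltW q0)// ?mulVf ?gt_eqF//.
rewrite normrM gtr0_norm ?invr_gt0// mulrC ler_pdivrMr//; lra.
Qed.

(** * Restricted measures and weighted products of square-integrable functions *)

Section measure_facts.
Context d (T : measurableType d) (R : realType).
Implicit Types (nu : {measure set T -> \bar R}) (D : set T).

Lemma ge0_integral_mrestr nu D (mD : measurable D) (f : T -> \bar R) :
  (forall x, 0 <= f x)%E -> measurable_fun setT f ->
  (\int[mrestr nu mD]_x f x = \int[nu]_(x in D) f x)%E.
Proof.
move=> f0 mf.
rewrite [LHS](@ge0_negligible_integral _ _ _ _ _ (~` D))//; last first.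
- by rewrite /= /mrestr /= setICl measure0.
- exact: measurableC.
rewrite setTD setCK; apply: eq_measure_integral => A mA AD.
by rewrite /= /mrestr setIidl.
Qed.

Lemma Rintegral0_eq nu D (f : T -> R) : (forall x, D x -> f x = 0) ->
  \int[nu]_(x in D) f x = 0.
Proof.
by move=> f0; rewrite /Rintegral integral0_eq// => x Dx; rewrite f0.
Qed.

(** Pointwise, [|f| * |g| <= f ^+ 2 + g ^+ 2], divided by the weight. With [w = 1] this controls the
    boundary pairings in L^2; with [w] a power of the distance and [f], [g] replaced by differences
    it controls the Gagliardo forms. Where [w] vanishes, division by zero gives 0 on both sides. *)
Lemma weighted_product_integrable nu D (k f g w : T -> R) (M : R) :
  measurable D -> 0 <= M -> measurable_fun D k -> measurable_fun D f ->
  measurable_fun D g -> measurable_fun D w -> (forall x, 0 <= w x) ->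
  {ae nu, forall x, D x -> `|k x| <= M} ->
  (\int[nu]_(x in D) (f x ^+ 2 / w x)%:E < +oo)%E ->
  (\int[nu]_(x in D) (g x ^+ 2 / w x)%:E < +oo)%E ->
  nu.-integrable D (EFin \o (fun x => k x * (f x * g x / w x))) /\
  `|\int[nu]_(x in D) (k x * (f x * g x / w x))| <=
    M * (fine (\int[nu]_(x in D) (f x ^+ 2 / w x)%:E) +
         fine (\int[nu]_(x in D) (g x ^+ 2 / w x)%:E)).
Proof.
move=> mD M0 mk mf mg mw w0 kM f2 g2.
have mV : measurable_fun D (fun x => (w x)^-1).
  under eq_fun do rewrite -powR_inv1//.
  exact: (measurableT_comp (measurable_powR (-1))).
have mkfg : measurable_fun D (fun x => k x * (f x * g x / w x)).
  by apply: measurable_funM => //; do 2 apply: measurable_funM => //.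
have mf2 : measurable_fun D (fun x => f x ^+ 2 / w x).
  by apply: measurable_funM => //; exact: measurable_funX.
have mg2 : measurable_fun D (fun x => g x ^+ 2 / w x).
  by apply: measurable_funM => //; exact: measurable_funX.
have q0 (h : T -> R) x : 0 <= h x ^+ 2 / w x.
  by rewrite mulr_ge0 ?sqr_ge0 ?invr_ge0.
have I0 (h : T -> R) : (0 <= \int[nu]_(x in D) (h x ^+ 2 / w x)%:E)%E.
  by apply: integral_ge0 => x _; rewrite lee_fin.
have bnd : (\int[nu]_(x in D) `|(k x * (f x * g x / w x))%:E| <=
    (M * (fine (\int[nu]_(x in D) (f x ^+ 2 / w x)%:E) +
         fine (\int[nu]_(x in D) (g x ^+ 2 / w x)%:E)))%:E)%E.
  rewrite EFinM EFinD !fineK ?ge0_fin_numE//.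
  rewrite -ge0_integralD//; last 4 first.
  - by move=> x _; rewrite lee_fin.
  - exact/measurable_EFinP.
  - by move=> x _; rewrite lee_fin.
  - exact/measurable_EFinP.
  rewrite -ge0_integralZl//; last 2 first.
  - by apply/measurable_EFinP; exact: measurable_funD.
  - by move=> x _; rewrite -EFinD lee_fin addr_ge0.
  apply: ae_ge0_le_integral => //.
  - by apply: measurableT_comp => //; exact/measurable_EFinP.
  - by move=> x _; rewrite mule_ge0// ?lee_fin// addr_ge0.
  - apply/measurable_EFinP; apply: measurable_funM => //.
    exact: measurable_funD.
  apply: filterS kM => x kM Dx; rewrite -EFinD -EFinM lee_fin normrM.
  apply: ler_pM => //; first exact: kM.
  rewrite -mulrDl !normrM [X in _ * X <= _]ger0_norm ?invr_ge0//.
  rewrite ler_wpM2r ?invr_ge0//.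
  have := sqr_ge0 (`|f x| - `|g x|).
  rewrite -(real_normK (num_real (f x))) -(real_normK (num_real (g x))).
  have := normr_ge0 (f x); have := normr_ge0 (g x); nra.
have int : nu.-integrable D (EFin \o (fun x => k x * (f x * g x / w x))).
  apply/integrableP; split; first exact/measurable_EFinP.
  by apply: le_lt_trans bnd _; exact: ltry.
split=> //; rewrite -lee_fin EFin_normr_Rintegral//.
by apply: le_trans bnd; apply: le_abse_integral => //; exact/measurable_EFinP.
Qed.

End measure_facts.

(** * Sections of almost-everywhere statements *)

Section ae_sections.
Context d1 d2 d3 (T1 : measurableType d1) (T2 : measurableType d2)
  (T3 : measurableType d3) (R : realType).

(** By definition of the product measure, the exceptional set has measure the integral of the
    measures of its sections; a nonnegative function with zero integral vanishes almost
    everywhere. *)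
Lemma ae_xsection (m1 : {measure set T1 -> \bar R})
    (m2 : {sigma_finite_measure set T2 -> \bar R}) (P : T1 * T2 -> Prop) :
  {ae (m1 \x m2)%E, forall q, P q} ->
  {ae m1, forall t, {ae m2, forall x, P (t, x)}}.
Proof.
move=> [A [mA A0 PA]].
have : ae_eq m1 setT (m2 \o xsection A) (cst 0%E).
  apply/ae_eq_integral_abs => //; first exact: measurable_fun_xsection.
  rewrite -[RHS]A0 /product_measure1; apply: eq_integral => x _.
  by rewrite gee0_abs.
apply: filterS => t /(_ I) At; exists (xsection A t); split.
- exact: measurable_xsection.
- exact: At.
- by move=> x nP; rewrite xsectionE/=; apply: PA.
Qed.

(** The triple product is nested to the left, whereas the section at [t] must be measured by
    [m2 \x m3]. The map [h t] regroups the variables, and Tonelli identifies the measure of the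
    regrouped section with the inner integral of the sections by [m3]. *)
Lemma ae_xsection2 (m1 : {sigma_finite_measure set T1 -> \bar R})
    (m2 : {sigma_finite_measure set T2 -> \bar R})
    (m3 : {sigma_finite_measure set T3 -> \bar R}) (P : T1 * T2 * T3 -> Prop) :
  {ae (m1 \x m2 \x m3)%E, forall q, P q} ->
  {ae m1, forall t, {ae (m2 \x m3)%E, forall z, P (t, z.1, z.2)}}.
Proof.
move=> [A [mA A0 PA]].
pose h t (z : T2 * T3) : T1 * T2 * T3 := (t, z.1, z.2).
have mh t : measurable_fun setT (h t).
  apply/measurable_fun_pair; last exact: measurable_snd.
  by apply/measurable_fun_pair => //; exact: measurable_fst.
have mhA t : measurable (h t @^-1` A).
  by rewrite -[X in measurable X]setTI; exact: mh.
have mF := measurable_fun_xsection m3 mA.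
have : ae_eq m1 setT (fun t => (m2 \x m3)%E (h t @^-1` A)) (cst 0%E).
  have mhF t : (m2 \x m3)%E (h t @^-1` A) = fubini_F m2 (m3 \o xsection A) t.
    rewrite /product_measure1 /fubini_F; apply: eq_integral => x _ /=.
    by congr (m3 _); apply/seteqP; split => y; rewrite !xsectionE.
  rewrite (_ : (fun t => _) = fubini_F m2 (m3 \o xsection A)); last exact/funext.
  apply/ae_eq_integral_abs => //.
    by apply: measurable_fun_fubini_tonelli_F => //= q.
  rewrite -[RHS]A0 [RHS]/product_measure1 fubini_tonelli1//.
  apply: eq_integral => x _; rewrite gee0_abs// /fubini_F.
  by apply: integral_ge0.
apply: filterS => t /(_ I) At; exists (h t @^-1` A); split => //.
by move=> z nP; apply: PA.
Qed.

End ae_sections.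

(** The interval has positive length, so a null set cannot contain it. This selects a time at which
    bounds valid for almost every time do hold. *)
Lemma ae_lebesgue_itv (R : realType) (T : R) (P : R -> Prop) : 0 < T ->
  {ae @lebesgue_measure R, forall t, P t} -> exists2 t, 0 <= t <= T & P t.
Proof.
move=> T0 [A [mA A0 PA]]; apply: contrapT => H.
have : (@lebesgue_measure R `[0%R, T] <= 0)%E.
  rewrite -A0; apply: le_measure; rewrite ?inE// => t /=.
  by rewrite in_itv/= => tT; apply: PA => Pt; apply: H; exists t.
by rewrite lebesgue_measure_itv/= lte_fin T0 sube0 lee_fin leNgt T0.
Qed.

(** * Euclidean norm, volume of balls, and finiteness of the boundary measure *)

Section euclidean_facts.
Variables (R : realType) (N : nat).
Local Notation X := 'rV[R]_N.
Local Notation L := (lebesgue_rV R N).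
Implicit Types (x y : X) (D : set X).

Lemma enorm_ge0 x : 0 <= enorm x.
Proof. exact: sqrtr_ge0. Qed.

Lemma sqr_enorm x : enorm x ^+ 2 = \sum_(i < N) x 0 i ^+ 2.
Proof. by rewrite sqr_sqrtr// sumr_ge0// => i _; rewrite sqr_ge0. Qed.

Lemma coord_le_enorm x i : `|x 0 i| <= enorm x.
Proof.
rewrite -(@ler_pXn2r _ 2)// ?nnegrE ?enorm_ge0// sqr_enorm real_normK ?num_real//.
by rewrite (bigD1 i)//= lerDl sumr_ge0// => j _; rewrite sqr_ge0.
Qed.

Lemma enorm0 : enorm (0 : X) = 0.
Proof. by rewrite /enorm big1 ?sqrtr0// => i _; rewrite mxE expr0n. Qed.

Lemma coord_le_mx_norm x i : `|x 0 i| <= `|x|.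
Proof. by rewrite [leRHS]/Num.Def.normr/= mx_normrE (le_bigmax _ _ (0, i)). Qed.

(** Here [|x|] is the maximum norm that carries the topology. The factor [N%:R], cruder than its
    square root, comes from [N <= N ^ 2] after squaring. *)
Lemma enorm_le_mx_norm x : enorm x <= N%:R * `|x|.
Proof.
rewrite -(@ler_pXn2r _ 2)// ?nnegrE ?enorm_ge0// ?mulr_ge0//.
rewrite sqr_enorm exprMn.
apply: (@le_trans _ _ (\sum_(i < N) `|x| ^+ 2)).
  apply: ler_sum => i _; rewrite -(real_normK (num_real (x 0 i))).
  by rewrite lerXn2r ?nnegrE// coord_le_mx_norm.
rewrite sumr_const card_ord -[leLHS]mulr_natl ler_wpM2r ?sqr_ge0//.
by rewrite -natrX ler_nat; case: (N) => // n; rewrite -mulnn leq_pmulr.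
Qed.

Lemma enorm_continuous : continuous (@enorm R N).
Proof.
move=> x; rewrite /enorm; apply: continuous_comp; last exact: sqrt_continuous.
apply: (@continuous_big _ _ (fun a c : R => a + c) 0) => [|i _].
  exact: add_continuous.
move=> z; apply: (@continuous_comp _ _ _ (fun x : X => x 0 i) (fun a => a ^+ 2)).
  exact: coord_continuous.
exact: exprn_continuous.
Qed.

Lemma open_eball x r : open (eball x r).
Proof.
rewrite (_ : eball x r = (fun y => enorm (x - y)) @^-1` [set t | t < r])//.
apply: open_comp => [y _|]; last exact: open_lt.
apply: continuous_comp; last exact: enorm_continuous.
by apply: continuousB; [exact: cst_continuous|exact: cvg_id].
Qed.

Lemma measurable_enorm : measurable_fun setT (@enorm R N).
Proof.
rewrite (_ : @enorm R N = fun x => (\sum_(i < N) x 0 i ^+ 2) `^ 2^-1); last first.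
  by apply/funext => x; rewrite powR12_sqrt// sumr_ge0// => i _; rewrite sqr_ge0.
apply: (measurableT_comp (measurable_powR 2^-1)).
apply: measurable_sum => i; apply: measurable_funX; exact: measurable_coord.
Qed.

Lemma measurable_enormB :
  measurable_fun setT (fun z : X * X => enorm (z.1 - z.2)).
Proof.
apply: (measurableT_comp measurable_enorm); apply: measurable_fun_rV => j.
rewrite (_ : (fun _ => _) = (fun z : X * X => z.1 0 j - z.2 0 j)); last first.
  by apply/funext => z; rewrite !mxE.
by apply: measurable_funB;
  [apply: (measurableT_comp (measurable_coord 0 j) measurable_fst)|
   apply: (measurableT_comp (measurable_coord 0 j) measurable_snd)].
Qed.

Lemma measurable_diagonal_strip D r : measurable D ->
  measurable [set z : X * X | D z.1 /\ D z.2 /\ enorm (z.1 - z.2) < r].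
Proof.
move=> mD; rewrite (_ : [set z | _] = (D `*` D) `&`
    (fun z : X * X => enorm (z.1 - z.2)) @^-1` (`]-oo, r[%classic : set R)).
  apply: measurableI; first exact: measurableX.
  by rewrite -[X in measurable X]setTI; exact: measurable_enormB.
by apply/seteqP; split => z; rewrite /= in_itv/=; tauto.
Qed.

(** The Euclidean ball lies in the cube of side [2 * r] with the same centre. *)
Lemma lebesgue_rV_eball x r : 0 <= r -> (L (eball x r) <= ((2 * r) ^+ N)%:E)%E.
Proof.
move=> r0.
pose I (i : 'I_N) : set R := `]x 0 i - r, x 0 i + r[%classic.
have mI i : measurable (I i) by exact: measurable_itv.
have mbox : measurable [set y : X | forall i, I i (y 0 i)].
  rewrite (_ : [set y | _] = \bigcap_(i in [set: 'I_N])
      ((fun y : X => y 0 i) @^-1` I i)).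
    apply: fin_bigcap_measurable => // i _.
    by rewrite -[X in measurable X]setTI; exact: measurable_coord.
  by apply/seteqP; split => [y Iy i _|y Iy i]; exact: Iy.
apply: (@le_trans _ _ (L [set y | forall i, I i (y 0 i)])).
  apply: le_measure; rewrite ?inE//.
    by apply: open_measurable_mx; exact: open_eball.
  move=> y /= yr i; rewrite /I/= in_itv/=.
  have := le_lt_trans (coord_le_enorm (x - y) i) yr.
  by rewrite !mxE distrC ltr_distl.
rewrite lebesgue_rV_box// (eq_bigr (fun=> (2 * r)%:E)); last first.
  move=> i _; rewrite /I lebesgue_measure_itv/= lte_fin.
  case: ifPn => [_|]; first by rewrite -EFinB; congr EFin; ring.
  by rewrite -leNgt => ?; congr EFin; lra.
by rewrite prodEFin lee_fin prodr_const card_ord.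
Qed.

Lemma bounded_set_enorm D : bounded_set D ->
  exists2 M : R, 0 < M & forall x y, D x -> D y -> enorm (x - y) < M.
Proof.
move=> [M0 [_ DM0]]; pose M := M0 + 1.
have DM x : D x -> `|x| <= M by apply: DM0; rewrite ltrDl.
exists (N%:R * (`|M| + `|M|) + 1).
  by rewrite ltr_wpDl// mulr_ge0// addr_ge0.
move=> x y Dx Dy; rewrite (le_lt_trans (enorm_le_mx_norm _))//.
rewrite ltr_pwDr// ler_wpM2l// (le_trans (ler_normB _ _))//.
by rewrite lerD// (le_trans _ (ler_norm _))// DM.
Qed.

Lemma lebesgue_rV_bounded D : bounded_set D -> measurable D -> (L D < +oo)%E.
Proof.
move=> /bounded_set_enorm[M M0 DM] mD.
have [->|/set0P[x Dx]] := eqVneq D set0; first by rewrite measure0.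
apply: (@le_lt_trans _ _ (L (eball x M))); last first.
  by apply: le_lt_trans (lebesgue_rV_eball x (ltW M0)) _; exact: ltry.
apply: le_measure; rewrite ?inE//.
  by apply: open_measurable_mx; exact: open_eball.
by move=> y Dy; exact: DM.
Qed.

Lemma compact_boundary D : bounded_set D -> compact (boundary D).
Proof.
move=> bD; apply: bounded_closed_compact; last first.
  rewrite /boundary setDE; apply: closedI; first exact: closed_closure.
  by apply: open_closedC; exact: open_interior.
case: bD => M [Mr DM]; exists M; split => // r Mr' x [cx _].
apply: contrapT => /negP; rewrite -ltNge => rx.
(* This ball around [x] lies outside the closed ball of radius [r] about the origin, yet it meets
   [D], contradicting the bound on [D]. *)
have /cx[y [Dy]] : nbhs x (ball x (`|x| - r)).
  by apply: nbhsx_ballx; rewrite subr_gt0.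
rewrite -ball_normE/= => xy; have := DM _ Mr' _ Dy.
have := ler_normD (x - y) y; rewrite subrK; move: xy => /=; lra.
Qed.

(** Compactness gives a finite cover by unit balls centred in [D], and the upper d-set inequality at
    radius 1 bounds the measure of each piece. *)
Lemma d_set_measure_lty d (mu : {measure set X -> \bar R}) D :
  measurable D -> compact D -> d_set d mu D -> (mu D < +oo)%E.
Proof.
move=> mD cD [_ _ [c1 [c2 [_ _ H]]]].
have mB x : measurable (eball x 1 `&` D).
  by apply: measurableI => //; apply: open_measurable_mx; exact: open_eball.
move: cD; rewrite compact_cover => /(_ X D (fun x => eball x 1)).
case=> [x _|x Dx|D' D'D DD'].
- exact: open_eball.
- by exists x => //; rewrite /eball/= subrr enorm0.
pose fin_mu A := measurable A /\ (mu A < +oo)%E.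
suff [_] : fin_mu (\big[setU/set0]_(x <- finmap.enum_fset D') (eball x 1 `&` D)).
  congr (mu _ < _)%E; rewrite -bigcup_fset.
  apply/seteqP; split => [x [y _ []//]|x Dx].
  by have [y D'y yx] := DD' _ Dx; exists y.
rewrite big_seq.
apply: big_ind => [|A B [mA A1] [mB' B1]|x xD'].
- by rewrite /fin_mu measure0.
- split; first exact: measurableU.
  by apply: le_lt_trans (measureU2 _ _ _) _ => //; exact: lte_add_pinfty.
- split=> //; have Dx : D x by apply/set_mem; exact: D'D.
  have /andP[_ /le_lt_trans] := H x 1 Dx ltac:(by rewrite ltr01 lexx).
  by apply; exact: ltry.
Qed.
End euclidean_facts.

(** * Finiteness of the Gagliardo seminorm of Lipschitz functions *)

Lemma geometric_nneseries_lty (R : realType) (a q : R) : 0 <= a -> 0 <= q < 1 ->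
  (\sum_(0 <= k <oo) (a * q ^+ k)%:E < +oo)%E.
Proof.
move=> a0 /andP[q0 q1]; have q10 : 0 < 1 - q by rewrite subr_gt0.
apply: (@le_lt_trans _ _ (a / (1 - q))%:E); last exact: ltry.
apply: lime_le.
  by apply: is_cvg_nneseries => k _ _; rewrite lee_fin mulr_ge0// exprn_ge0.
apply: nearW => n; rewrite sumEFin lee_fin.
have -> : \sum_(0 <= k < n) a * q ^+ k = a / (1 - q) - a * q ^+ n / (1 - q).
  elim: n => [|n IHn]; first by rewrite big_geq// expr0 mulr1 subrr.
  by rewrite big_nat_recr//= IHn exprS; field; rewrite gt_eqF.
by rewrite gerBl divr_ge0 ?mulr_ge0 ?exprn_ge0 ?(ltW q10).
Qed.

(** Take the least index satisfying the lower bound: the upper bound is its minimality, or [g < r]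
    when the index is 0. *)
Lemma dyadic_shell (R : realType) (r g : R) : 0 < g < r ->
  exists k, r * 2^-1 ^+ k.+1 <= g < r * 2^-1 ^+ k.
Proof.
move=> /andP[g0 gr]; have r0 := lt_trans g0 gr.
have : exists n, r * 2^-1 ^+ n.+1 <= g.
  exists (Num.bound (r / g)).
  have := upper_nthrootP (leqnSn (Num.bound (r / g))).
  rewrite ltr_pdivrMr// => /ltW.
  by rewrite exprVn ler_pdivrMr ?exprn_gt0// mulrC.
move=> /ex_minnP[[|k] kg kmin]; first by exists 0; rewrite kg expr0 mulr1.
by exists k.+1; rewrite kg ltNge; apply/negP => /kmin; rewrite ltnn.
Qed.

Section lipschitz_gagliardo.
Variables (R : realType) (N : nat).
Local Notation X := 'rV[R]_N.
Local Notation L := (lebesgue_rV R N).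

Lemma is_derive_segment (f : X -> R) (x v : X) (t : R) :
  differentiable f (x + t *: v) ->
  is_derive t 1 (fun r : R => f (x + r *: v)) ('D_v f (x + t *: v)).
Proof.
move=> df; have fv : derivable f (x + t *: v) v by exact: diff_derivable.
have E : (fun h : R => h^-1 *: (((fun r : R => f (x + r *: v)) \o shift t) (h *: 1)
      - f (x + t *: v))) =
    (fun h : R => h^-1 *: ((f \o shift (x + t *: v)) (h *: v) - f (x + t *: v))).
  apply/funext => h /=; congr (_ *: (f _ - _)).
  by rewrite scalerDl [h%:A]mulr1 addrCA.
split; first by rewrite /derivable E.
by rewrite /derive E.
Qed.

(** Mean value theorem along the segment from [y] to [x], which stays in the ball by convexity. The
    directional derivative is expanded in partial derivatives, each bounded on the compact ball; [C]
    is the sum of these bounds. *)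
Lemma C1_lipschitz_on_ball (f : X -> R) (M : R) :
  (forall x, differentiable f x) ->
  (forall i, continuous (fun x => 'D_(delta_mx 0 i) f x)) ->
  exists2 C : R, 0 <= C & forall x y, `|x| <= M -> `|y| <= M ->
    `|f x - f y| <= C * enorm (x - y).
Proof.
move=> df cf.
pose B : set X := [set x | `|x| <= M].
have cB : compact B.
  apply: bounded_closed_compact.
    exists M; split; first exact: num_real.
    by move=> r Mr x /= /le_trans; apply; exact: ltW.
  rewrite (_ : B = Num.norm @^-1` [set r | r <= M])//.
  by apply: closed_comp; [move=> x _; exact: norm_continuous|exact: closed_le].
have bnd i : exists c, forall x, B x -> `|'D_(delta_mx 0 i) f x| <= c.
  have : compact ((fun x => 'D_(delta_mx 0 i) f x) @` B).
    by apply: continuous_compact => //; exact: continuous_subspaceT.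
  move=> /compact_bounded[c [_ Bc]]; exists (c + 1) => x Bx.
  by apply: Bc; [rewrite ltrDl|exists x].
have [c cP] := choice bnd.
exists (\sum_i `|c i|) => [|x y xM yM]; first exact: sumr_ge0.
pose v := x - y.
have dsum p : 'D_v f p = \sum_i v 0 i * 'D_(delta_mx 0 i) f p.
  rewrite deriveE// [in LHS](row_sum_delta v) linear_sum.
  by apply: eq_bigr => i _; rewrite linearZ deriveE.
have [] := @MVT R (fun r : R => f (y + r *: v)) (fun r => 'D_v f (y + r *: v)) 0 1 ltr01.
- by move=> r _; exact: is_derive_segment.
- apply: continuous_subspaceT => r; apply: differentiable_continuous.
  by apply/derivable1_diffP; have [] := @is_derive_segment f y v r (df _).
move=> r; rewrite in_itv/= => /andP[r0 r1].
rewrite scale1r scale0r addr0 subr0 mulr1 (_ : y + v = x); last by rewrite addrC subrK.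
move=> ->; rewrite dsum mulr_suml; apply: le_trans (ler_norm_sum _ _ _) _.
apply: ler_sum => i _; rewrite normrM mulrC ler_pM// ?coord_le_enorm//.
apply: le_trans (ler_norm _); apply: cP; rewrite /B/=.
rewrite (_ : y + r *: v = (1 - r) *: y + r *: x); last first.
  by rewrite /v scalerBr scalerBl scale1r addrCA addrC.
apply: le_trans (ler_normD _ _) _; rewrite !normrZ.
rewrite !ger0_norm ?subr_ge0 ?(ltW r0) ?(ltW r1)//.
have : (1 - r) * `|y| <= (1 - r) * M by rewrite ler_wpM2l// subr_ge0 ltW.
have : r * `|x| <= r * M by rewrite ler_wpM2l// ltW.
lra.
Qed.

Lemma measurable_gagliardo (D : set X) (e : R) (f : X -> R) :
  measurable D -> measurable_fun D f ->
  measurable_fun (D `*` D)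
    (fun z => (f z.1 - f z.2) ^+ 2 / enorm (z.1 - z.2) `^ e).
Proof.
move=> mD mf.
have mDD : measurable (D `*` D) by exact: measurableX.
apply: measurable_funM.
  apply: measurable_funX; apply: measurable_funB.
    apply: (measurable_comp mD) => //; first by move=> _ [z [Dz _] <-].
    exact: measurable_funTS measurable_fst.
  apply: (measurable_comp mD) => //; first by move=> _ [z [_ Dz] <-].
  exact: measurable_funTS measurable_snd.
apply: measurable_funTS.
under eq_fun do rewrite -powR_inv1 ?powR_ge0//.
apply: (measurableT_comp (measurable_powR (-1))).
apply: (measurableT_comp (measurable_powR e)); exact: measurable_enormB.
Qed.

(** Integrate over the first variable in [D]: each section of the strip sits in a ball of radius
    [r]. *)
Lemma product_lebesgue_near_diagonal (D : set X) (r : R) : measurable D -> 0 <= r ->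
  ((L \x L) [set z | D z.1 /\ D z.2 /\ (enorm (z.1 - z.2)%R < r)%R]
    <= ((2 * r) ^+ N)%:E * L D)%E.
Proof.
move=> mD r0; set S := [set z | _].
have mS : measurable S by exact: measurable_diagonal_strip.
apply: (@le_trans _ _ (\int[L]_x (((2 * r) ^+ N)%:E * (\1_D x)%:E))%E); last first.
  have m1 : measurable_fun setT (fun x => (\1_D x : R)%:E).
    by apply/measurable_EFinP; exact: measurable_indic.
  have k0 : (0 <= ((2 * r) ^+ N)%:E)%E by rewrite lee_fin exprn_ge0// mulr_ge0.
  by rewrite ge0_integralZl// integral_indic// setIT.
apply: ge0_le_integral => //.
- exact: measurable_fun_xsection.
- apply: emeasurable_funM => //; apply/measurable_EFinP; exact: measurable_indic.
move=> x _ /=; rewrite indicE; have [xD|xD] := boolP (x \in D).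
  rewrite mule1; apply: le_trans (lebesgue_rV_eball x r0).
  apply: le_measure; rewrite ?inE; last by move=> y; rewrite xsectionE => -[_ []].
    exact: measurable_xsection.
  by apply: open_measurable_mx; exact: open_eball.
rewrite mule0 (_ : xsection S x = set0) ?measure0//.
apply/seteqP; split => // y; rewrite xsectionE => -[/= Dx _].
by move: xD; rewrite notin_setE.
Qed.

(* On the dyadic shell |x - y| ~ r 2^-k the integral is at most a constant times
   2^(-2k) 2^(k (N + 2s)) 2^(-kN) = (2^(2s - 2))^k. *)
Lemma gagliardo_lipschitz_lty (D : set X) (s M : R) (f : X -> R) :
  bounded_set D -> measurable D -> 0 < s < 1 -> measurable_fun D f ->
  (forall x y, D x -> D y -> `|f x - f y| <= M * enorm (x - y)) ->
  (gagliardo L (D `*` D) (N%:R + 2 * s) f < +oo)%E.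
Proof.
move=> bD mD /andP[s0 s1] mf fM.
have [r r0 Dr] := bounded_set_enorm bD.
have mDD : measurable (D `*` D) by exact: measurableX.
set E := N%:R + 2 * s.
have E0 : 0 < E by rewrite /E ltr_wpDl// mulr_gt0.
pose h (k : nat) : R := 2^-1 ^+ k.
have h0 k : 0 < h k by rewrite exprn_gt0.
(* The sets [S k] are nested neighbourhoods of the diagonal rather than shells: the [k]-th shell is
   contained in [S k], and the extra terms of the series are nonnegative. *)
pose S k := [set z : X * X | D z.1 /\ D z.2 /\ enorm (z.1 - z.2) < r * h k].
have mS k : measurable (S k) by exact: measurable_diagonal_strip.
(* An upper bound of the integrand on the [k]-th shell: the Lipschitz numerator is taken at the
   outer radius, the kernel at the inner one. *)
pose c k := M ^+ 2 * (r * h k) ^+ 2 / (r * h k.+1) `^ E.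
have c0 k : 0 <= c k.
  by rewrite divr_ge0 ?powR_ge0// mulr_ge0 ?sqr_ge0.
have mcS k : measurable_fun (D `*` D) (fun z => (c k * \1_(S k) z)%:E).
  by apply/measurable_EFinP; apply: measurable_funM.
have le_series : (gagliardo L (D `*` D) E f <=
    \int[L \x L]_(z in D `*` D) (\sum_(0 <= k <oo) (c k * \1_(S k) z)%:E))%E.
  apply: ge0_le_integral => //.
  - by move=> z _; rewrite lee_fin mulr_ge0 ?sqr_ge0 ?invr_ge0 ?powR_ge0.
  - by apply/measurable_EFinP; exact: measurable_gagliardo.
  - by apply: ge0_emeasurable_sum => // k z _; rewrite lee_fin mulr_ge0.
  move=> z [Dz1 Dz2]; set g := enorm (z.1 - z.2).
  have sum0 : (0 <= \sum_(0 <= k <oo) (c k * \1_(S k) z)%:E)%E.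
    by apply: nneseries_ge0 => k _ _; rewrite lee_fin mulr_ge0.
  (* At distance zero the Lipschitz bound makes the numerator vanish; otherwise the point belongs to
     a dyadic shell. *)
  have := enorm_ge0 (z.1 - z.2); rewrite -/g le_eqVlt => /predU1P[g0|g0].
    have := fM _ _ Dz1 Dz2; rewrite -/g -g0 mulr0 normr_le0 => /eqP ->.
    by rewrite expr0n mul0r.
  have [k /andP[kg gk]] := @dyadic_shell R r g ltac:(by rewrite g0 Dr).
  have Sk : S k z by [].
  apply: (@le_trans _ _ (c k * \1_(S k) z)%:E); last first.
    rewrite (@nneseriesD1 _ _ k)//=; last by move=> j _; rewrite lee_fin mulr_ge0.
    by rewrite leeDl//; apply: nneseries_ge0 => j _ _; rewrite lee_fin mulr_ge0.
  rewrite lee_fin indicE mem_set// mulr1 /c; apply: ler_pM.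
  - exact: sqr_ge0.
  - by rewrite invr_ge0 powR_ge0.
  - rewrite -exprMn -(real_normK (num_real (_ - _))).
    (* The sign of [M] follows from the Lipschitz bound at a pair of points at positive distance. *)
    have M0 : 0 <= M.
      by rewrite -(pmulr_lge0 _ g0) (le_trans _ (fM _ _ Dz1 Dz2)).
    rewrite lerXn2r ?nnegrE//; first by rewrite !mulr_ge0// ltW.
    by apply: le_trans (fM _ _ Dz1 Dz2) _; rewrite ler_wpM2l// ltW.
  - rewrite lef_pV2 ?posrE ?powR_gt0 ?mulr_gt0//.
    have rk : 0 < r * h k.+1 by rewrite mulr_gt0.
    by apply: ge0_ler_powR; rewrite ?nnegrE ?(ltW E0) ?(ltW rk) ?(ltW g0).
apply: le_lt_trans le_series _.
rewrite integral_nneseries//; last by move=> k z _; rewrite lee_fin mulr_ge0.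
have LD := lebesgue_rV_bounded bD mD.
pose l := fine (L D).
have l0 : 0 <= l by exact: fine_ge0.
(* The ratio of the dominating geometric series; it is below 1 because [s < 1]. *)
pose q : R := 2^-1 `^ (2 - 2 * s).
have q1 : 0 <= q < 1.
  have e0 : 0 < 2 - 2 * s by lra.
  have := @gt0_ltr_powR R _ e0 2^-1 1; rewrite powR1 !nnegrE powR_ge0/=.
  by apply => //; lra.
(* Chosen so that [c k] times the volume bound for [S k] equals exactly [a * q ^+ k]. *)
pose a := M ^+ 2 * r ^+ 2 * (2 * r) ^+ N * l / (r * 2^-1) `^ E.
have a0 : 0 <= a.
  have rN : 0 <= (2 * r) ^+ N by rewrite exprn_ge0// mulr_ge0// ltW.
  by rewrite divr_ge0 ?powR_ge0// mulr_ge0// mulr_ge0// mulr_ge0// sqr_ge0.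
apply: le_lt_trans (geometric_nneseries_lty a0 q1).
apply: lee_nneseries => [k _ _|k _].
  by apply: integral_ge0 => z _; rewrite lee_fin mulr_ge0.
under eq_integral do rewrite EFinM.
have m1 : measurable_fun (D `*` D) (fun z => (\1_(S k) z : R)%:E).
  by apply/measurable_EFinP; apply: measurable_funTS; exact: measurable_indic.
rewrite ge0_integralZl ?lee_fin// integral_indic//; apply: (@le_trans _ _
    ((c k)%:E * (((2 * (r * h k)) ^+ N)%:E * L D))%E).
  rewrite lee_wpmul2l ?lee_fin// (le_trans _ (product_lebesgue_near_diagonal mD _))//.
    apply: le_measure; rewrite ?inE//; first exact: measurableI.
    exact: (mS k).
  by rewrite mulr_ge0// ltW.
rewrite -[L D]fineK ?ge0_fin_numE// -!EFinM lee_fin -/l le_eqVlt; apply/orP; left.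
have hE : h k `^ E = (2^-1 `^ E) ^+ k.
  have b0 : 0 <= 2^-1 :> R by rewrite invr_ge0.
  by rewrite /h -(powR_mulrn k b0) -(powR_mulrn k (powR_ge0 _ E)) -!powRrM mulrC.
(* The exponents add up as (2 - 2s) + (N + 2s) = 2 + N: the square of the Lipschitz bound and the
   volume of the strip supply the factor on the right. *)
have qE : q * 2^-1 `^ E = 2^-1 ^+ 2 * 2^-1 ^+ N :> R.
  rewrite /q -powRD; last by rewrite invr_eq0 pnatr_eq0 implybT.
  rewrite -!powR_mulrn ?invr_ge0// -powRD; last by rewrite invr_eq0 pnatr_eq0 implybT.
  by congr (_ `^ _); rewrite /E; ring.
have qk : h k ^+ 2 * h k ^+ N = q ^+ k * h k `^ E.
  by rewrite hE -exprMn qE exprMn /h [_ ^+ k ^+ 2]exprAC [_ ^+ k ^+ N]exprAC.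
have hEk : (r * h k.+1) `^ E = (r * 2^-1) `^ E * h k `^ E.
  by rewrite /h exprS mulrA powRM// ?exprn_ge0 ?invr_ge0// mulr_ge0 ?invr_ge0// ltW.
have u0 : (r * 2^-1) `^ E != 0 by rewrite gt_eqF// powR_gt0// mulr_gt0.
have v0 : h k `^ E != 0 by rewrite gt_eqF// powR_gt0.
rewrite /c /a hEk !exprMn.
apply/eqP; transitivity (M ^+ 2 * r ^+ 2 * (2 ^+ N * r ^+ N) * l *
    (h k ^+ 2 * h k ^+ N) / ((r * 2^-1) `^ E * h k `^ E)).
  by field; rewrite u0 v0.
by rewrite qk; field; rewrite u0 v0.
Qed.

End lipschitz_gagliardo.

(** * Splitting the measure m into its bulk and boundary parts *)

Section bulk_boundary.
Variables (R : realType) (N : nat).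
Local Notation X := 'rV[R]_N.
Local Notation L := (lebesgue_rV R N).
Variables (mu : {sigma_finite_measure set X -> \bar R}) (Omega : set X).
Variable oOmega : open Omega.
Local Notation m := (bulk_bdry mu oOmega).
Local Notation F := (boundary Omega).

Lemma ge0_integral_bulk_bdry (f : X -> \bar R) :
  (forall x, 0 <= f x)%E -> measurable_fun setT f ->
  (\int[m]_x f x = \int[L]_(x in Omega) f x + \int[mu]_(x in F) f x)%E.
Proof.
move=> f0 mf; rewrite /bulk_bdry ge0_integral_measure_add//.
by rewrite !ge0_integral_mrestr.
Qed.

Lemma integrable_bulk_bdry (f : X -> \bar R) : m.-integrable setT f ->
  L.-integrable Omega f /\ mu.-integrable F f.
Proof.
move=> /integrableP[mf].
rewrite ge0_integral_bulk_bdry//; last exact: measurableT_comp.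
move=> fi; split; apply/integrableP; (split; first exact: measurable_funTS).
  by apply: le_lt_trans fi; rewrite leeDl// integral_ge0.
by apply: le_lt_trans fi; rewrite leeDr// integral_ge0.
Qed.

(** Additivity in the measure is applied to the positive and negative parts separately;
    integrability makes the pieces finite, so the extended-real differences can be regrouped. *)
Lemma Rintegral_bulk_bdry (f : X -> R) : m.-integrable setT (EFin \o f) ->
  \int[m]_x f x = \int[L]_(x in Omega) f x + \int[mu]_(x in F) f x.
Proof.
move=> fi; have [f1 f2] := integrable_bulk_bdry fi.
have mf := measurable_int _ fi.
have mp := measurable_funepos mf; have mn := measurable_funeneg mf.
rewrite /Rintegral -fineD; last 2 first.
- by apply: integrable_fin_num => //; exact: open_measurable_mx.
- by apply: integrable_fin_num => //; exact: measurable_boundary.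
congr fine.
have Hp : (\int[m]_x (EFin \o f)^\+ x =
    \int[L]_(x in Omega) (EFin \o f)^\+ x + \int[mu]_(x in F) (EFin \o f)^\+ x)%E.
  exact: ge0_integral_bulk_bdry.
have Hn : (\int[m]_x (EFin \o f)^\- x =
    \int[L]_(x in Omega) (EFin \o f)^\- x + \int[mu]_(x in F) (EFin \o f)^\- x)%E.
  exact: ge0_integral_bulk_bdry.
transitivity (\int[m]_x (EFin \o f)^\+ x - \int[m]_x (EFin \o f)^\- x)%E.
  by rewrite [LHS]integralE.
rewrite Hp Hn [X in (_ = X + _)%E]integralE [X in (_ = _ + X)%E]integralE.
have fn : (\int[mu]_(x in F) (EFin \o f)^\- x)%E \is a fin_num.
  apply: integrable_fin_num; first exact: measurable_boundary.
  by apply: integrable_funeneg => //; exact: measurable_boundary.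
by rewrite (fin_num_oppeD _ fn) addeACA.
Qed.

(** A sum of two nonnegative measures vanishes on a set only if both do. This is how one identity in
    L^2(m) yields a bulk equation and a boundary equation. *)
Lemma ae_bulk_bdry (P : X -> Prop) : {ae m, forall x, P x} ->
  {ae L, forall x, Omega x -> P x} /\ {ae mu, forall x, F x -> P x}.
Proof.
move=> [A [mA A0 PA]].
have mO := open_measurable_mx oOmega; have mF := measurable_boundary Omega.
have [L0 mu0] : L (A `&` Omega) = 0%E /\ mu (A `&` F) = 0%E.
  have mE B : m B = (L (B `&` Omega) + mu (B `&` F))%E.
    exact: (@measure_addE _ X R (mrestr L (open_measurable_mx oOmega))
      (mrestr mu (measurable_boundary Omega)) B).
  have : (L (A `&` Omega) + mu (A `&` F) = 0)%E by rewrite -mE.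
  by move/eqP; rewrite padde_eq0// => /andP[/eqP ? /eqP ?].
split; [exists (A `&` Omega)|exists (A `&` F)]; split => //.
- exact: measurableI.
- by move=> x /= /not_implyP[Ox nP]; split => //; exact: PA.
- exact: measurableI.
- by move=> x /= /not_implyP[Ox nP]; split => //; exact: PA.
Qed.

Lemma Lfun2_measurable (f : X -> R) : f \in Lfun m 2%:E -> measurable_fun setT f.
Proof. by rewrite inE => /andP[/[!inE]]. Qed.

Lemma Lfun2_L2_on (f : X -> R) : f \in Lfun m 2%:E ->
  L2_on L Omega f /\ L2_on mu F f.
Proof.
move=> f2; have mf := Lfun2_measurable f2.
have [+ +] := integrable_bulk_bdry (Lfun2_integrable_sqr f2).
move=> /integrableP[_ i1] /integrableP[_ i2].
split; (split; first exact: measurable_funTS).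
  apply: le_lt_trans i1; rewrite /sq_integral le_eqVlt; apply/orP; left; apply/eqP.
  by apply: eq_integral => x _ /=; rewrite ger0_norm ?sqr_ge0.
apply: le_lt_trans i2; rewrite /sq_integral le_eqVlt; apply/orP; left; apply/eqP.
by apply: eq_integral => x _ /=; rewrite ger0_norm ?sqr_ge0.
Qed.

Lemma L2_on_Lfun2 (f : X -> R) : measurable_fun setT f ->
  (sq_integral L Omega f < +oo)%E -> (sq_integral mu F f < +oo)%E ->
  f \in Lfun m 2%:E.
Proof.
move=> mf f1 f2; rewrite inE; apply/andP; split; rewrite inE//= /finite_norm.
rewrite unlock; apply: poweR_lty.
have mf2 : measurable_fun setT (fun x => (f x ^+ 2)%:E).
  by apply/measurable_EFinP; exact: measurable_funX.
rewrite (eq_integral (fun x => (f x ^+ 2)%:E)).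
  rewrite ge0_integral_bulk_bdry//; last by move=> x; rewrite lee_fin sqr_ge0.
  exact: lte_add_pinfty.
by move=> x _; rewrite /= powR_mulrn// real_normK// num_real.
Qed.

Lemma integrable_Lfun2_mul (f g : X -> R) : f \in Lfun m 2%:E -> g \in Lfun m 2%:E ->
  m.-integrable setT (EFin \o (fun x => f x * g x)).
Proof. by move=> f2 g2; apply/Lfun1_integrable; exact: Lfun2_mul_Lfun1. Qed.

End bulk_boundary.

(** * Comparing the full Gagliardo integral with the Besov norm *)

Lemma ge0_integral_prod_mul d1 d2 (T1 : measurableType d1) (T2 : measurableType d2)
    (R : realType) (m1 : {sigma_finite_measure set T1 -> \bar R})
    (m2 : {sigma_finite_measure set T2 -> \bar R})
    (f : T1 -> \bar R) (g : T2 -> \bar R) :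
  measurable_fun setT f -> measurable_fun setT g ->
  (forall x, 0 <= f x)%E -> (forall y, 0 <= g y)%E ->
  (\int[m1 \x m2]_z (f z.1 * g z.2) = \int[m1]_x f x * \int[m2]_y g y)%E.
Proof.
move=> mf mg f0 g0; rewrite fubini_tonelli1//; last 2 first.
- by apply: emeasurable_funM;
    [exact: (measurableT_comp mf measurable_fst)|
     exact: (measurableT_comp mg measurable_snd)].
- by move=> z; rewrite mule_ge0.
rewrite -ge0_integralZr//; last exact: integral_ge0.
by apply: eq_integral => x _; rewrite /fubini_F/= ge0_integralZl.
Qed.

Section besov_pairings.
Variables (R : realType) (N : nat).
Local Notation X := 'rV[R]_N.
Variables (mu : {sigma_finite_measure set X -> \bar R}) (F : set X).
Hypothesis mF : measurable F.

Let mFF : measurable (F `*` F). Proof. exact: measurableX. Qed.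

Lemma sq_integral_ge0 (g : X -> R) : (0 <= sq_integral mu F g)%E.
Proof. by apply: integral_ge0 => x _; rewrite lee_fin sqr_ge0. Qed.

Lemma gagliardo_ge0 (D : set (X * X)) (e : R) (g : X -> R) :
  (0 <= gagliardo mu D e g)%E.
Proof.
by apply: integral_ge0 => z _; rewrite lee_fin divr_ge0 ?sqr_ge0 ?powR_ge0.
Qed.

(** Extension by zero turns each integrand into a product of a function of one variable and the
    indicator of [F] in the other. *)
Lemma integral_prod_sq (g : X -> R) : measurable_fun F g ->
  (\int[mu \x mu]_(z in F `*` F) (g z.1 ^+ 2)%:E = sq_integral mu F g * mu F)%E /\
  (\int[mu \x mu]_(z in F `*` F) (g z.2 ^+ 2)%:E = sq_integral mu F g * mu F)%E.
Proof.
move=> mg.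
pose G := ((fun x => (g x ^+ 2)%:E) \_ F)%E.
pose I x : \bar R := (\1_F x)%:E.
have mG : measurable_fun setT G.
  apply/(measurable_restrictT _ mF); apply/measurable_EFinP.
  exact: measurable_funX.
have mI : measurable_fun setT I by apply/measurable_EFinP; exact: measurable_indic.
have G0 x : (0 <= G x)%E.
  by rewrite /G patchE; case: ifPn => // _; rewrite lee_fin sqr_ge0.
have I0 x : (0 <= I x)%E by rewrite lee_fin.
have IG : (\int[mu]_x G x = sq_integral mu F g)%E by rewrite -integral_mkcond.
have II : (\int[mu]_x I x = mu F)%E by rewrite integral_indic// setIT.
split.
- rewrite -IG -II -(ge0_integral_prod_mul _ _ mG mI)// integral_mkcond.
  apply: eq_integral => -[x y] _; rewrite patchE/= /G /I patchE indicE in_setX/=.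
  by case: (x \in F); case: (y \in F); rewrite /= ?mule1 ?mule0 ?mul0e.
rewrite muleC -IG -II -(ge0_integral_prod_mul _ _ mI mG)// integral_mkcond.
apply: eq_integral => -[x y] _; rewrite patchE/= /G /I patchE indicE in_setX/=.
by case: (x \in F); case: (y \in F); rewrite /= ?mul1e ?mule0 ?mul0e.
Qed.

(* Off the diagonal strip the kernel is at most 1, so (a - b)^2 <= 2a^2 + 2b^2
   suffices there. *)
Lemma gagliardo_le_near (e : R) (g : X -> R) : 0 <= e -> measurable_fun F g ->
  (gagliardo mu (F `*` F) e g <= gagliardo mu (near_diagonal F) e g +
     4%:E * (sq_integral mu F g * mu F))%E.
Proof.
move=> e0 mg; have mN : measurable (near_diagonal F) by exact: measurable_diagonal_strip.
have NF : near_diagonal F `<=` F `*` F by move=> z [? [? _]].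
have mk := measurable_gagliardo e mF mg.
(* The boolean selects the coordinate, so that both squares are treated at once. *)
have mgi i : measurable_fun (F `*` F) (fun z : X * X =>
    (2 * g (if i then z.1 else z.2) ^+ 2)%:E).
  apply/measurable_EFinP; apply: measurable_funM => //; apply: measurable_funX.
  by case: i; apply: (measurable_comp mF) => //;
    do ?[by move=> _ [z [? ?] <-]]; apply: measurable_funTS;
    [exact: measurable_fst|exact: measurable_snd].
rewrite /gagliardo -{1}(setDUK NF) ge0_integral_setU//; last 4 first.
- exact: measurableD.
- by rewrite setDUK//; exact/measurable_EFinP.
- by move=> z _; rewrite lee_fin divr_ge0 ?sqr_ge0 ?powR_ge0.
- by apply/disj_setPS => z [? []].
rewrite leeD2l//.
have [E1 E2] := integral_prod_sq mg.
apply: (@le_trans _ _ (\int[mu \x mu]_(z in F `*` F)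
    ((2 * g z.1 ^+ 2)%:E + (2 * g z.2 ^+ 2)%:E))%E); last first.
  rewrite ge0_integralD//; last 4 first.
  - by move=> z _; rewrite lee_fin mulr_ge0 ?sqr_ge0.
  - exact: (mgi true).
  - by move=> z _; rewrite lee_fin mulr_ge0 ?sqr_ge0.
  - exact: (mgi false).
  have P i : (\int[mu \x mu]_(z in F `*` F) (2 * g (if i then z.1 else z.2) ^+ 2)%:E =
      2%:E * (sq_integral mu F g * mu F))%E.
    under eq_integral do rewrite EFinM.
    rewrite ge0_integralZl//; first by case: i; rewrite ?E1 ?E2.
      apply/measurable_EFinP; apply: measurable_funX.
      by case: i {mgi}; apply: (measurable_comp mF) => //;
        do ?[by move=> _ [z [? ?] <-]]; apply: measurable_funTS;
        [exact: measurable_fst|exact: measurable_snd].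
    by move=> z _; rewrite lee_fin sqr_ge0.
  rewrite (P true) (P false) -ge0_muleDl//.
  by rewrite -EFinD (_ : 2 + 2 = 4)//; lra.
apply: (@le_trans _ _ (\int[mu \x mu]_(z in (F `*` F) `\` near_diagonal F)
    ((2 * g z.1 ^+ 2)%:E + (2 * g z.2 ^+ 2)%:E))%E); last first.
  apply: ge0_subset_integral => //; first exact: measurableD.
    by apply: emeasurable_funD; [exact: (mgi true)|exact: (mgi false)].
  by move=> z _; rewrite -EFinD lee_fin addr_ge0// mulr_ge0// sqr_ge0.
apply: ge0_le_integral.
- exact: measurableD.
- by move=> z _; rewrite lee_fin divr_ge0 ?sqr_ge0 ?powR_ge0.
- by apply/measurable_EFinP; apply: measurable_funS mk.
- apply: (@measurable_funS _ _ _ _ (F `*` F)) => //.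
  by apply: emeasurable_funD; [exact: (mgi true)|exact: (mgi false)].
move=> z [[F1 F2] nN]; rewrite -EFinD lee_fin.
have d1 : 1 <= enorm (z.1 - z.2).
  by rewrite leNgt; apply/negP => ?; apply: nN.
have k1 : 1 <= enorm (z.1 - z.2) `^ e.
  by rewrite -(powRr0 (enorm (z.1 - z.2))) ler_powR.
apply: (@le_trans _ _ ((g z.1 - g z.2) ^+ 2)).
  by rewrite ler_pdivrMr ?(lt_le_trans ltr01)// ler_peMr// sqr_ge0.
have := sqr_ge0 (g z.1 + g z.2); rewrite !expr2; lra.
Qed.

End besov_pairings.

(** * Bounds on the coefficients at every fixed time *)

Section coefficients_at_fixed_time.
Variables (R : realType) (N : nat).
Local Notation X := 'rV[R]_N.
Variables (nu : {sigma_finite_measure set X -> \bar R}) (D : set X).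
Hypothesis mD : measurable D.
Variables (T t eta : R).
Hypotheses (T0 : 0 < T) (tT : 0 <= t <= T).

(** The assumed bounds may fail on a null set of times, which could include [t]. They are taken at a
    good time [tau] and carried over to [t] by the Hoelder condition. *)
Lemma coefficient_at (k1 k2 : R) (k : R -> X -> X -> R) :
  coefficient nu D T k1 k2 eta k ->
  measurable_fun (D `*` D) (fun z => k t z.1 z.2) /\
  exists2 M, 0 <= M &
    {ae (nu \x nu)%E, forall z, (D `*` D) z -> `|k t z.1 z.2| <= M}.
Proof.
move=> [mk _ /andP[k10 k12] kb [C kC]]; split.
  pose h (z : X * X) : measurableTypeR R * X * X := (t, z.1, z.2).
  have mh : measurable_fun setT h.
    apply/measurable_fun_pair; last exact: measurable_snd.
    by apply/measurable_fun_pair => //; exact: measurable_fst.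
  apply: (measurable_comp _ _ mk (measurable_funTS mh)).
    by apply: measurableX => //; apply: measurableX => //; exact: measurable_itv.
  by move=> _ [z [Dz1 Dz2] <-]; split => //; split => //=; rewrite in_itv.
have [tau tauT taub] := ae_lebesgue_itv T0 (ae_xsection2 kb).
have k20 : 0 <= k2 by rewrite ltW// (lt_trans k10).
(* The bound at [tau] plus the Hoelder increment between [tau] and [t]; the absolute value covers a
   negative [C]. *)
exists (k2 + `|C * `|t - tau| `^ eta|) => [|]; first by rewrite addr_ge0.
have := kC t tau tT tauT.
apply: filterS2 taub => z /= taub tC [Dz1 Dz2].
have := tC Dz1 Dz2; have /andP[l1 l2] := taub tauT Dz1 Dz2.
have := ler_norm (C * `|t - tau| `^ eta).
have := ler_normD (k t z.1 z.2 - k tau z.1 z.2) (k tau z.1 z.2); rewrite subrK.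
rewrite (ger0_norm (_ : 0 <= k tau _ _)); last first.
  by rewrite (le_trans (ltW k10)).
lra.
Qed.

Lemma potential_at (b0 : R) (b : R -> X -> R) : potential nu D T b0 eta b ->
  measurable_fun D (b t) /\
  exists2 M, 0 <= M & {ae nu, forall x, D x -> `|b t x| <= M}.
Proof.
move=> [mb [M bM] _ _ [C bC]]; split.
  pose h (x : X) : measurableTypeR R * X := (t, x).
  have mh : measurable_fun setT h by exact/measurable_fun_pair.
  apply: (measurable_comp _ _ mb (measurable_funTS mh)).
    by apply: measurableX => //; exact: measurable_itv.
  by move=> _ [x Dx <-]; split => //=; rewrite in_itv.
have [tau tauT taub] := ae_lebesgue_itv T0 (ae_xsection bM).
exists (`|M| + `|C * `|t - tau| `^ eta|) => [|]; first by rewrite addr_ge0.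
have := bC t tau tT tauT.
apply: filterS2 taub => x /= taub tC Dx.
have := tC Dx; have := taub tauT Dx.
have := ler_norm (C * `|t - tau| `^ eta); have := ler_norm M.
have := ler_normD (b t x - b tau x) (b tau x); rewrite subrK.
lra.
Qed.

End coefficients_at_fixed_time.

(** * Continuity of the explicit boundary functional on the Besov space *)

Section boundary_functional.
Variables (R : realType) (N : nat).
Local Notation X := 'rV[R]_N.
Variables (mu : {sigma_finite_measure set X -> \bar R}) (F : set X).
Hypotheses (mF : measurable F) (muF : (mu F < +oo)%E).
Variables (d alpha : R).
Hypothesis e0 : 0 <= d + 2 * alpha.
Local Notation besovF := (besov mu F d alpha).
Local Notation B g := (fine (besov_sqnorm mu F d alpha g)).
Local Notation c0 := (1 + 4 * fine (mu F)).

(** The Besov norm integrates only over pairs at distance less than 1. The constant [c0] absorbs the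
    remaining pairs, whose contribution is at most 4 mu(F) times the squared L^2 norm. *)
Lemma besov_bounds (g : X -> R) : besovF g ->
  [/\ L2_on mu F g, (gagliardo mu (F `*` F) (d + 2 * alpha) g < +oo)%E,
      fine (sq_integral mu F g) <= B g &
      fine (gagliardo mu (F `*` F) (d + 2 * alpha) g) <= c0 * B g].
Proof.
move=> [mg Bg].
have S0 := sq_integral_ge0 mu F g.
have G0 := gagliardo_ge0 mu (near_diagonal F) (d + 2 * alpha) g.
have GF0 := gagliardo_ge0 mu (F `*` F) (d + 2 * alpha) g.
have Soo : (sq_integral mu F g < +oo)%E by apply: le_lt_trans Bg; rewrite leeDl.
have Goo : (gagliardo mu (near_diagonal F) (d + 2 * alpha) g < +oo)%E.
  by apply: le_lt_trans Bg; rewrite leeDr.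
have := gagliardo_le_near mu mF e0 mg; rewrite /besov_sqnorm.
have mu0 : (0 <= mu F)%E by exact: measure_ge0.
move: S0 G0 GF0 Soo Goo mu0 muF.
case: (sq_integral mu F g) => [S| |]//.
case: (gagliardo mu (near_diagonal F) _ g) => [G| |]//.
case: (gagliardo mu (F `*` F) _ g) => [GF| |]//; case: (mu F) => [m| |]//.
rewrite -!EFinM -!EFinD !lee_fin => S0 G0 GF0 _ _ m0 _ H /=; split => //=.
- by split => //; apply: le_lt_trans Bg; rewrite leeDl// gagliardo_ge0.
- exact: ltry.
- lra.
- have := mulr_ge0 m0 G0; have := mulr_ge0 m0 S0; lra.
Qed.

Lemma besov_scale (c : R) (g : X -> R) : besovF g ->
  besovF (c \*o g) /\ B (c \*o g) = c ^+ 2 * B g.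
Proof.
move=> [mg Bg].
have S0 := sq_integral_ge0 mu F g.
have G0 := gagliardo_ge0 mu (near_diagonal F) (d + 2 * alpha) g.
have NF : near_diagonal F `<=` F `*` F by move=> z [? [? _]].
have mN : measurable (near_diagonal F) by exact: measurable_diagonal_strip.
have E : (besov_sqnorm mu F d alpha (c \*o g) =
    (c ^+ 2)%:E * besov_sqnorm mu F d alpha g)%E.
  have msq : measurable_fun F (fun x => (g x ^+ 2)%:E).
    by apply/measurable_EFinP; exact: measurable_funX.
  have mgag : measurable_fun (near_diagonal F) (fun z : X * X =>
      ((g z.1 - g z.2) ^+ 2 / enorm (z.1 - z.2) `^ (d + 2 * alpha))%:E).
    apply/measurable_EFinP; apply: (measurable_funS (measurableX mF mF) NF).
    exact: measurable_gagliardo.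
  have sq0 x : (0 <= (g x ^+ 2)%:E)%E by rewrite lee_fin sqr_ge0.
  have gag0 (z : X * X) :
      (0 <= ((g z.1 - g z.2) ^+ 2 / enorm (z.1 - z.2) `^ (d + 2 * alpha))%:E)%E.
    by rewrite lee_fin divr_ge0 ?sqr_ge0 ?powR_ge0.
  rewrite /besov_sqnorm ge0_muleDr//; congr (_ + _)%E.
    rewrite /sq_integral -ge0_integralZl ?lee_fin ?sqr_ge0//.
    by apply: eq_integral => x _; rewrite -EFinM /= exprMn.
  rewrite /gagliardo -ge0_integralZl ?lee_fin ?sqr_ge0//.
  by apply: eq_integral => z _; rewrite -EFinM /= -mulrBr exprMn [in RHS]mulrA.
have B0 : (0 <= besov_sqnorm mu F d alpha g)%E by rewrite adde_ge0.
split; first split.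
- exact: measurable_funM.
- by rewrite E lte_mul_pinfty// lee_fin sqr_ge0.
- by rewrite E fineM// ge0_fin_numE.
Qed.

Lemma besov0 : besovF (cst 0).
Proof.
split=> //; rewrite /besov_sqnorm /sq_integral /gagliardo.
rewrite !integral0_eq ?adde0// => z _; first by rewrite subr0 expr0n mul0r.
by rewrite expr0n.
Qed.

(* Applying the bound to c g for all c and optimising in c makes it homogeneous. *)
Lemma besov_dual_of_quadratic_bound (ell : (X -> R) -> R) (C : R) : 0 <= C ->
  (forall (c : R) f g, besovF f -> besovF g ->
     ell (c \*o f \+ g) = c * ell f + ell g) ->
  (forall g, besovF g -> `|ell g| <= C * (1 + B g)) ->
  besov_dual mu F d alpha ell.
Proof.
move=> C0 lin bnd; split=> //; exists (2 * C) => g Bg.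
have ell0 : ell (cst 0) = 0.
  have := lin 1 _ _ besov0 besov0.
  rewrite (_ : 1 \*o cst 0 \+ cst 0 = cst 0); last first.
    by apply/funext => x /=; rewrite mulr0 addr0.
  lra.
apply: quadratic_form_bound => // [|c].
  by rewrite fine_ge0// adde_ge0 ?sq_integral_ge0 ?gagliardo_ge0.
have [Bcg <-] := besov_scale c Bg; apply: le_trans (bnd _ Bcg).
rewrite (_ : c \*o g = c \*o g \+ cst 0); last first.
  by apply/funext => x /=; rewrite addr0.
by rewrite lin ?ell0 ?addr0//; exact: besov0.
Qed.

Lemma L2_pairing (k f g : X -> R) (M : R) : 0 <= M -> measurable_fun F k ->
  {ae mu, forall x, F x -> `|k x| <= M} -> L2_on mu F f -> L2_on mu F g ->
  mu.-integrable F (EFin \o (fun x => k x * f x * g x)) /\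
  `|\int[mu]_(x in F) (k x * f x * g x)| <=
    M * (fine (sq_integral mu F f) + fine (sq_integral mu F g)).
Proof.
move=> M0 mk kM [mf f2] [mg g2].
have sqE h : (\int[mu]_(x in F) (h x ^+ 2 / cst 1 x)%:E = sq_integral mu F h)%E.
  by apply: eq_integral => x _; rewrite divr1.
have [] := @weighted_product_integrable _ X R mu F k f g (cst 1) M mF M0 mk mf mg
  (measurable_cst _) (fun=> ler01) kM.
- by rewrite sqE.
- by rewrite sqE.
rewrite !sqE (_ : (fun x => _) = fun x => k x * f x * g x)//.
by apply/funext => x; rewrite divr1 mulrA.
Qed.

Lemma L2_mul_pairing (f g : X -> R) : L2_on mu F f -> L2_on mu F g ->
  mu.-integrable F (EFin \o (fun x => f x * g x)) /\
  `|\int[mu]_(x in F) (f x * g x)| <=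
    fine (sq_integral mu F f) + fine (sq_integral mu F g).
Proof.
move=> f2 g2; have [] := @L2_pairing (cst 1) f g 1 ler01 (measurable_cst _) _ f2 g2.
  by apply: aeW => x _; rewrite normr1.
rewrite (_ : (fun x => _) = fun x => f x * g x); last first.
  by apply/funext => x; rewrite mul1r.
by rewrite mul1r.
Qed.

(** The weighted product estimate on [F * F], applied to the differences of [f] and of [g] with the
    power of the distance as weight. *)
Lemma gagliardo_pairing (k : X -> X -> R) (f g : X -> R) (M : R) : 0 <= M ->
  measurable_fun (F `*` F) (fun z => k z.1 z.2) ->
  {ae (mu \x mu)%E, forall z, (F `*` F) z -> `|k z.1 z.2| <= M} ->
  besovF f -> besovF g ->
  (mu \x mu)%E.-integrable (F `*` F) (EFin \o (fun z => k z.1 z.2 *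
    ((f z.1 - f z.2) * (g z.1 - g z.2) / enorm (z.1 - z.2) `^ (d + 2 * alpha)))) /\
  `|gagliardo_form mu F (d + 2 * alpha) k f g| <= M * (c0 * (B f + B g)).
Proof.
move=> M0 mk kM Bf Bg.
have [[mf _] fG _ fB] := besov_bounds Bf; have [[mg _] gG _ gB] := besov_bounds Bg.
have mdiff (h : X -> R) : measurable_fun F h ->
    measurable_fun (F `*` F) (fun z : X * X => h z.1 - h z.2).
  move=> mh; apply: measurable_funB; apply: (measurable_comp mF) => //;
    do ?[by move=> _ [z [? ?] <-]]; apply: measurable_funTS;
    [exact: measurable_fst|exact: measurable_snd].
have mw : measurable_fun (F `*` F)
    (fun z : X * X => enorm (z.1 - z.2) `^ (d + 2 * alpha)).
  apply: measurable_funTS; apply: (measurableT_comp (measurable_powR _)).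
  exact: measurable_enormB.
have [int bnd] := @weighted_product_integrable _ (X * X)%type R (mu \x mu)%E (F `*` F)
  (fun z => k z.1 z.2) (fun z => f z.1 - f z.2) (fun z => g z.1 - g z.2)
  (fun z => enorm (z.1 - z.2) `^ (d + 2 * alpha)) M (measurableX mF mF) M0 mk
  (mdiff _ mf) (mdiff _ mg) mw (fun=> powR_ge0 _ _) kM fG gG.
split=> //; apply: le_trans bnd _; rewrite ler_wpM2l//.
by rewrite mulrDr lerD.
Qed.

(** Each of the three terms is linear in [g], and its absolute value is bounded by an affine
    function of [B g], which is what the quadratic criterion asks for. *)
Lemma besov_dual_boundary_functional (w b u : X -> R) (k : X -> X -> R) (Mb Mk : R) :
  L2_on mu F w -> besovF u -> 0 <= Mb -> 0 <= Mk ->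
  measurable_fun F b -> {ae mu, forall x, F x -> `|b x| <= Mb} ->
  measurable_fun (F `*` F) (fun z => k z.1 z.2) ->
  {ae (mu \x mu)%E, forall z, (F `*` F) z -> `|k z.1 z.2| <= Mk} ->
  besov_dual mu F d alpha (fun g => \int[mu]_(x in F) (w x * g x) -
    \int[mu]_(x in F) (b x * u x * g x) - gagliardo_form mu F (d + 2 * alpha) k u g).
Proof.
move=> w2 Bu Mb0 Mk0 mb bM mk kM.
have [u2 _ _ _] := besov_bounds Bu.
have Pw g : besovF g -> mu.-integrable F (EFin \o (fun x => w x * g x)) /\
    `|\int[mu]_(x in F) (w x * g x)| <= fine (sq_integral mu F w) + B g.
  move=> Bg; have [g2 _ gB _] := besov_bounds Bg.
  have [i1 i2] := L2_mul_pairing w2 g2.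
  by split=> //; apply: le_trans i2 _; rewrite lerD2l.
have Pb g : besovF g -> mu.-integrable F (EFin \o (fun x => b x * u x * g x)) /\
    `|\int[mu]_(x in F) (b x * u x * g x)| <= Mb * (fine (sq_integral mu F u) + B g).
  move=> Bg; have [g2 _ gB _] := besov_bounds Bg.
  have [i1 i2] := L2_pairing Mb0 mb bM u2 g2.
  by split=> //; apply: le_trans i2 _; rewrite ler_wpM2l// lerD2l.
have Pk g Bg := @gagliardo_pairing k u g Mk Mk0 mk kM Bu Bg.
have B0 g : 0 <= B g by rewrite fine_ge0// adde_ge0 ?sq_integral_ge0 ?gagliardo_ge0.
have S0 g : 0 <= fine (sq_integral mu F g) by rewrite fine_ge0// sq_integral_ge0.
have c00 : 0 <= c0 by rewrite addr_ge0// mulr_ge0// fine_ge0.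
(* The added ones make [C] dominate both the constant term and the coefficient of [B g] in the sum
   of the three bounds. *)
pose C := fine (sq_integral mu F w) + 1 + Mb * (fine (sq_integral mu F u) + 1)
  + Mk * (c0 * (B u + 1)).
have C0 : 0 <= C by rewrite /C !addr_ge0// !mulr_ge0// addr_ge0.
apply: (besov_dual_of_quadratic_bound C0) => [c f g Bf Bg|g Bg]; last first.
  have [_ w1] := Pw _ Bg; have [_ b1] := Pb _ Bg; have [_ k1] := Pk _ Bg.
  apply: le_trans (ler_normB _ _) _.
  apply: le_trans (lerD (ler_normB _ _) (lexx _)) _.
  apply: le_trans (lerD (lerD w1 b1) k1) _; rewrite /C.
  have := B0 g; have := B0 u; have := S0 w; have := S0 u.
  move: (B g) (B u) (fine (sq_integral mu F w)) (fine (sq_integral mu F u)) (c0) c00.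
  move=> x y z v c c0' v0 z0 y0 x0.
  have q1 : 0 <= z * x by rewrite mulr_ge0.
  have q2 : 0 <= Mb * (v * x) by rewrite !mulr_ge0.
  have q3 : 0 <= Mk * (c * (y * x)) by rewrite !mulr_ge0.
  have q4 : 0 <= Mb by []. have q5 : 0 <= Mk * c by rewrite mulr_ge0.
  rewrite -subr_ge0 (_ : _ - _ = z * x + Mb * (v * x) + Mk * (c * (y * x)) + 1 + Mb
    + Mk * c); last by ring.
  by rewrite !addr_ge0.
have [wf _] := Pw _ Bf; have [wg _] := Pw _ Bg.
have [bf _] := Pb _ Bf; have [bg _] := Pb _ Bg.
have [kf _] := Pk _ Bf; have [kg _] := Pk _ Bg.
(* Linearity is stated for an arbitrary measure space because it is used both on [F] and on pairs of
   points of [F]. *)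
have lin (d' : measure_display) (Y : measurableType d') (nu : {measure set Y -> \bar R})
    (D : set Y) (h h1 h2 : Y -> R) : measurable D ->
    nu.-integrable D (EFin \o h1) -> nu.-integrable D (EFin \o h2) ->
    (forall x, h x = c * h1 x + h2 x) ->
    \int[nu]_(x in D) h x = c * \int[nu]_(x in D) h1 x + \int[nu]_(x in D) h2 x.
  move=> mD i1 i2 hE; rewrite -RintegralZl// -RintegralD//.
    by apply: eq_Rintegral => x _; exact: hE.
  exact: (integrableZl mD c i1).
rewrite /gagliardo_form.
rewrite (lin _ _ _ _ (fun x => w x * (c \*o f \+ g) x) _ _ mF wf wg); last first.
  by move=> x /=; ring.
rewrite (lin _ _ _ _ (fun x => b x * u x * (c \*o f \+ g) x) _ _ mF bf bg); last first.
  by move=> x /=; ring.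
rewrite (lin _ _ _ _ (fun z : X * X => k z.1 z.2 * ((u z.1 - u z.2) *
    ((c \*o f \+ g) z.1 - (c \*o f \+ g) z.2) / enorm (z.1 - z.2) `^ (d + 2 * alpha)))
    _ _ (measurableX mF mF) kf kg); last by move=> z /=; ring.
ring.
Qed.

End boundary_functional.

(** * Test functions as elements of H^s with zero trace *)

Section test_functions.
Variables (R : realType) (N : nat).
Local Notation X := 'rV[R]_N.
Local Notation L := (lebesgue_rV R N).

Lemma continuous_measurable_rV (f : X -> R) : continuous f -> measurable_fun setT f.
Proof.
move=> cf; apply: (measurability _ (RGenOpens.measurableE R)).
move=> _ [_ [a [b ->] <-]]; rewrite setTI; apply: open_measurable_mx.
by apply: open_comp (interval_open _ _) => // x _; exact: cf.
Qed.

(** Every boundary point has a neighbourhood missing [C], so the averages defining the trace are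
    zero for small radii, as is the value of [f] there. *)
Lemma is_trace_away_from_support (mu : {sigma_finite_measure set X -> \bar R})
    (Omega C : set X) (f : X -> R) : closed C -> boundary Omega `<=` ~` C ->
  (forall x, ~ C x -> f x = 0) -> is_trace mu Omega f f.
Proof.
move=> clC FC fC; apply: aeW => x Fx; rewrite fC; last exact: FC.
have : nbhs x (~` C) by apply: open_nbhs_nbhs; split; [exact: closed_openC|exact: FC].
move=> /nbhs_ballP[e /= e0 eC].
apply: cvg_near_cst; near=> r.
rewrite (@eq_Rintegral _ _ _ _ _ (cst 0)); first by rewrite /Rintegral integral0 mulr0.
(* The neighbourhood is a ball of the maximum norm; it contains the Euclidean ball of any smaller
   radius. *)
move=> y /set_mem[xy _]; apply: fC; apply: eC; split => // i j; rewrite ord1.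
have re : r < e by near: r; exact: nbhs_right_lt.
apply: lt_trans re; apply: le_lt_trans xy.
by have := coord_le_enorm (x - y) j; rewrite !mxE.
Unshelve. all: by end_near. Qed.

(** A test function is bounded, and Lipschitz on the bounded set [Omega], hence of finite Gagliardo
    seminorm since [s < 1]. Its support misses the boundary, so the Besov norm and the trace are
    zero. *)
Lemma test_function_Hs_trace (mu : {sigma_finite_measure set X -> \bar R})
    (Omega : set X) (oOmega : open Omega) (s d alpha : R) (v : X -> R) :
  bounded_set Omega -> 0 < s < 1 -> test_function Omega v ->
  Hs_trace mu oOmega s d alpha v /\ forall x, boundary Omega x -> v x = 0.
Proof.
move=> bO s01 [dv [C [cC CO] vC]].
have mO := open_measurable_mx oOmega; have mF := measurable_boundary Omega.
have FC : boundary Omega `<=` ~` C.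
  by move=> x [_ nO] /CO Ox; apply: nO; rewrite (proj1 (interior_id _) oOmega).
have vF x : boundary Omega x -> v x = 0 by move=> /FC; exact: vC.
(* The empty list of directions in [test_function] gives [v] itself; a list of length one, used
   below, gives its partial derivatives. *)
have diffv x : differentiable v x := dv [::] x.
have contv : continuous v by move=> x; exact: differentiable_continuous.
have mv := continuous_measurable_rV contv.
have [c vc] : exists c, forall x, `|v x| <= c.
  have /compact_bounded[M [_ MC]] : compact (v @` C).
    by apply: continuous_compact => //; exact: continuous_subspaceT.
  exists (`|M| + 1) => x; have [Cx|nCx] := pselect (C x).
    by apply: MC; [rewrite ltr_pwDr// ler_norm|exists x].
  by rewrite vC// normr0 addr_ge0.
have sqO : (sq_integral L Omega v < +oo)%E.
  apply: (@le_lt_trans _ _ (\int[L]_(x in Omega) (cst (c ^+ 2)%:E x))%E).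
    apply: ge0_le_integral => //.
    - by move=> x _; rewrite lee_fin sqr_ge0.
    - by apply/measurable_EFinP; apply: measurable_funX; exact: measurable_funTS.
    move=> x _; rewrite lee_fin -(real_normK (num_real (v x))).
    by rewrite lerXn2r ?nnegrE// (le_trans _ (vc x)).
  rewrite integral_cst// lte_mul_pinfty ?lee_fin ?sqr_ge0//.
  exact: lebesgue_rV_bounded.
have sqF : sq_integral mu (boundary Omega) v = 0%E.
  by apply: integral0_eq => x Fx; rewrite vF// expr0n.
split=> //; split.
- by apply: L2_on_Lfun2 => //; rewrite sqF ltry.
- split; first by split => //; exact: measurable_funTS.
  case: bO => M0 [_ OM]; have OM1 x : Omega x -> `|x| <= M0 + 1.
    by apply: OM; rewrite ltrDl.
  have [||K K0 vK] := @C1_lipschitz_on_ball R N v (M0 + 1).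
  + exact: diffv.
  + move=> i x; apply: differentiable_continuous.
    exact: (dv [:: delta_mx 0 i] x).
  apply: (@gagliardo_lipschitz_lty _ _ _ _ K) => //.
  + by exists M0; split; [exact: num_real|exact: OM].
  + exact: measurable_funTS.
  + by move=> x y Ox Oy; apply: vK; exact: OM1.
- split; first exact: measurable_funTS.
  rewrite /besov_sqnorm sqF add0e /gagliardo integral0_eq ?ltry//.
  by move=> z [F1 [F2 _]]; rewrite (vF _ F1) (vF _ F2) subr0 expr0n mul0r.
- apply: (@is_trace_away_from_support _ _ C) => //.
  by apply: compact_closed => //; exact: norm_hausdorff.
Qed.

End test_functions.

(** * The bulk equation, the conormal derivative and the boundary equation at a fixed time *)

Theorem theorem5p6 (R : realType) (N : nat)
    (eps delta d : R) (Omega : set 'rV[R]_N) (oOmega : open Omega)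
    (mu : {sigma_finite_measure set 'rV[R]_N -> \bar R})
    (hbounded : bounded_set Omega)
    (hdomain : eps_delta_domain eps delta Omega)
    (hdset : d_set d mu (boundary Omega))
    (hexhaust : lipschitz_exhaustion Omega)
    (s alpha : R) (hs : 0 < s < 1) (hNd : N%:R - d < 2 * s < N%:R)
    (halpha : alpha = s - (N%:R - d) / 2)
    (T : R) (hT : 0 < T) (eta : R) (heta : 2^-1 < eta < 1)
    (K zeta : R -> 'rV[R]_N -> 'rV[R]_N -> R) (k1 k2 zeta1 zeta2 : R)
    (hK : coefficient (lebesgue_rV R N) Omega T k1 k2 eta K)
    (hzeta : coefficient mu (boundary Omega) T zeta1 zeta2 eta zeta)
    (b : R -> 'rV[R]_N -> R) (b0 : R)
    (hb : potential mu (boundary Omega) T b0 eta b)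
    (DA : R -> set ('rV[R]_N -> R))
    (A : R -> ('rV[R]_N -> R) -> 'rV[R]_N -> R)
    (hA : forall t, 0 <= t <= T ->
       generator mu oOmega s d alpha K zeta b t (DA t) (A t))
    (U : R -> R -> ('rV[R]_N -> R) -> 'rV[R]_N -> R)
    (hU : evolution_family (bulk_bdry mu oOmega) T DA A U)
    (p : R) (hp : 1 < p) (lambda a rho : R)
    (hlambda : lambda = 2 * d / (d - N%:R + 2 * s))
    (ha : a = lambda / 4 * (1 - p^-1)) (hrho : 0 < rho < a)
    (l : R -> R) (J : ('rV[R]_N -> R) -> 'rV[R]_N -> R)
    (hJ : nonlinearity (bulk_bdry mu oOmega) p a rho l J)
    (phi : 'rV[R]_N -> R) (hphi : phi \in Lfun (bulk_bdry mu oOmega) 2%:E)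
    (kappa : R) (hkappa : 0 < kappa)
    (hphikappa : (limf_esup (fun t : R =>
         Lnorm (bulk_bdry mu oOmega) (2 * p)%:E
           (fun x => (t `^ rho * U t 0 phi x)%:E)) (0^'+) < kappa%:E)%E)
    (u du : R -> 'rV[R]_N -> R)
    (hu : cauchy_solution (bulk_bdry mu oOmega) T p DA A U J phi u du) :
  forall t, 0 < t <= T ->
  exists (Bu : 'rV[R]_N -> R) (CN : ('rV[R]_N -> R) -> R),
    [/\ is_bulk_op Omega s K t (u t) Bu,
        is_conormal mu oOmega s d alpha K t (u t) Bu CN,
        {ae (lebesgue_rV R N), forall x, Omega x -> du t x + Bu x = J (u t) x},
        forall v, besov mu (boundary Omega) d alpha v ->
          \int[mu]_(x in boundary Omega) (du t x * v x) + CN v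
          + \int[mu]_(x in boundary Omega) (b t x * u t x * v x)
          + Theta mu Omega d alpha zeta t (u t) v
          = \int[mu]_(x in boundary Omega) (J (u t) x * v x) &
        u 0 = phi %[ae (bulk_bdry mu oOmega)]].
Proof.
move=> t tT.
have t0T : 0 <= t <= T by case/andP: tT => /ltW -> ->.
have [[Au2 _ _ _] _ domt en] := hA _ t0T.
have [Dut _] := sol_domain hu tT.
have [ut_L2 wt_L2] := Au2 _ Dut.
have [_ _ But _] := domt _ Dut.
have [du2 _ _] := sol_C1 hu tT.
have J2 := nonlin_L2 hJ (proj1 (sol_L2p hu tT)).
(* The restriction of [w] to [Omega] will represent B u, and its restriction to the boundary enters
   the conormal derivative. *)
pose w := \- A t (u t).
have w2 : w \in Lfun (bulk_bdry mu oOmega) 2%:E.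
  rewrite (_ : w = -1 \o* A t (u t)); last by apply/funext => x /=; rewrite mulrN1.
  by apply: Lfun_scale => //; rewrite ler1n.
have mF := measurable_boundary Omega.
have muF := d_set_measure_lty mF (compact_boundary hbounded) hdset.
(* Substituting [alpha] gives d + 2 alpha = 2d + 2s - N, which exceeds d > 0 because N - d < 2s. *)
have e0 : 0 <= d + 2 * alpha by case/andP: hNd; case: hdset => /andP[]; lra.
have [mb [Mb Mb0 bM]] := potential_at mF hT t0T hb.
have [mz [Mz Mz0 zM]] := coefficient_at mF hT t0T hzeta.
have [wO wF] := Lfun2_L2_on w2.
(* The energy identity solved for the bulk form, with the pairing in L^2(m) split into its two
   parts. The bracket collects all boundary terms and is the future conormal derivative. *)
have split_energy v : Hs_trace mu oOmega s d alpha v ->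
    K_form Omega s K t (u t) v =
    \int[lebesgue_rV R N]_(x in Omega) (w x * v x) +
    (\int[mu]_(x in boundary Omega) (w x * v x) -
     \int[mu]_(x in boundary Omega) (b t x * u t x * v x) -
     Theta mu Omega d alpha zeta t (u t) v).
  move=> Hv; have := en _ _ Dut Hv; have [v2 _ _ _] := Hv.
  rewrite /L2dot (Rintegral_bulk_bdry (integrable_Lfun2_mul w2 v2)) /energy.
  by move/(canRL (addrK _))/(canRL (addrK _)) => ->; ring.
exists w, (fun v => \int[mu]_(x in boundary Omega) (w x * v x) -
  \int[mu]_(x in boundary Omega) (b t x * u t x * v x) -
  Theta mu Omega d alpha zeta t (u t) v); split.
(* A test function vanishes on the boundary, so the bracket of boundary terms is zero and only the
   bulk pairing survives. *)
- split=> // v /(test_function_Hs_trace mu oOmega d alpha hbounded hs)[Hv vF].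
  rewrite (split_energy _ Hv).
  have -> : \int[mu]_(x in boundary Omega) (w x * v x) = 0.
    by apply: Rintegral0_eq => x Fx; rewrite vF// mulr0.
  have -> : \int[mu]_(x in boundary Omega) (b t x * u t x * v x) = 0.
    by apply: Rintegral0_eq => x Fx; rewrite vF// mulr0.
  have -> : Theta mu Omega d alpha zeta t (u t) v = 0.
    apply: Rintegral0_eq => z [F1 F2].
    by rewrite (vF _ F1) (vF _ F2) subr0 mulr0 mul0r mulr0.
  by rewrite !subr0 addr0.
- split.
    exact: (besov_dual_boundary_functional mF muF e0 wF But Mb0 Mz0 mb bM mz zM).
  by move=> v Hv; rewrite (split_energy _ Hv) addKr.
- have [aeO _] := ae_bulk_bdry (sol_eq hu tT).
  by apply: filterS aeO => x eqx /eqx/(_ I) ->; rewrite /w /= addrAC subrr add0r.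
- move=> v Bv; have [v2 _ _ _] := besov_bounds mF muF e0 Bv.
  have [_ duF] := Lfun2_L2_on du2; have [_ JF] := Lfun2_L2_on J2.
  have [iw _] := L2_mul_pairing mF wF v2.
  have [idu _] := L2_mul_pairing mF duF v2.
  have [iJ _] := L2_mul_pairing mF JF v2.
  (* On the boundary the evolution equation reads J(u) = u' + w almost everywhere. Once it is
     integrated against [v], the terms in [b] and [Theta] cancel those subtracted in the conormal
     derivative. *)
  have -> : \int[mu]_(x in boundary Omega) (J (u t) x * v x) =
      \int[mu]_(x in boundary Omega) (du t x * v x) +
      \int[mu]_(x in boundary Omega) (w x * v x).
    rewrite -RintegralD//; congr fine; apply: ae_eq_integral => //.
    + exact: measurable_int iJ.
    + exact: measurable_int (integrableD mF idu iw).
    have [_ aeF] := ae_bulk_bdry (sol_eq hu tT).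
    apply: filterS aeF => x eqx Fx; congr EFin.
    by rewrite (eqx Fx I) /w/=; ring.
  ring.
- exact: sol_init hu.
Qed.
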